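(* For every $d\ge1$ let $$p^{\rm d}_{\rm c}(d)=\inf\Big\{p\in(0,1):\ 2(d-1)(d-2)(1-p^2)+4(d-1)p(1-p)+2\frac{1-p}{1-p(1-p)}+6(d-1)(1-p)<1\Big\}.$$ Then there exist $0<p_1<p_2<1$ with $p_2\le p^{\rm d}_{\rm c}(d)$ such that for every $p\in[0,1]\setminus[p_1,p_2]$ the thinned Bernoulli measure $\mu'_p=\mu_p\circ T^{-1}$ is a Gibbs measure, i.e. there exists a quasilocal specification $\gamma'$ for $\mu'_p$.
   Context: Let $d\ge1$, $\Omega=\{0,1\}^{\mathbb Z^d}$ with the product topology and Borel $\sigma$-algebra, and let $\mu_p$ be the i.i.d. Bernoulli product measure on $\Omega$ with $\mu_p(\omega_i=1)=p$ for all $i\in\mathbb Z^d$, $p\in[0,1]$. Write $i\sim j$ if $i,j\in\mathbb Z^d$ are nearest neighbors. The thinning map $T:\Omega\to\Omega$ is defined by $(T(\omega))_i=1$ if $\omega_i=1$ and $\omega_j=0$ for all $j\sim i$, and $(T(\omega))_i=0$ otherwise. Put $\Omega'=T(\Omega)\subset\Omega$ (with the subspace topology) and $\mu'_p=\mu_p\circ T^{-1}$. For $\Lambda\subset\mathbb Z^d$, $\omega_\Lambda$ denotes the restriction of $\omega$ to $\Lambda$; $\Lambda\Subset\mathbb Z^d$ means $\Lambda$ is a finite subset. A specification on $\Omega'$ is a family $\gamma=(\gamma_\Lambda)_{\Lambda\Subset\mathbb Z^d}$ of probability kernels $\gamma_\Lambda(\cdot|\omega)$ on $\Omega'$ ($\omega\in\Omega'$),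 with $\gamma_\Lambda(A|\omega)$ depending on $\omega$ only through $\omega_{\Lambda^c}$ for $A$ an event determined by the spins in $\Lambda$, which is proper ($\gamma_\Lambda(\cdot|\omega)$ is concentrated on configurations coinciding with $\omega$ on $\Lambda^c$) and consistent ($\int\gamma_\Delta(d\tilde\omega|\omega)\gamma_\Lambda(A|\tilde\omega)=\gamma_\Delta(A|\omega)$ for all $\Lambda\subset\Delta\Subset\mathbb Z^d$, all measurable $A\subset\Omega'$ and all $\omega\in\Omega'$). It is quasilocal if for all $\Lambda\Subset\mathbb Z^d$ and $\zeta_\Lambda\in\{0,1\}^\Lambda$ the map $\omega\mapsto\gamma_\Lambda(\zeta_\Lambda|\omega)$ is continuous on $\Omega'$, where $\gamma_\Lambda(\zeta_\Lambda|\omega)$ is the probability that the configuration equals $\zeta_\Lambda$ on $\Lambda$. It is a specification for a probability measure $\mu$ on $\Omega'$ if the DLR equations $\int\mu(d\tilde\omega)\gamma_\Lambda(A|\tilde\omega)=\mu(A)$ hold for all $\Lambda\Subset\mathbb Z^d$ and measurable $A$. *)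

(* Defs.v *)
From HB Require Import structures.
From mathcomp Require Export all_boot all_order all_algebra finmap.
From mathcomp Require Import zify.
From mathcomp Require Export all_classical all_reals all_analysis.
Export Order.TTheory GRing.Theory Num.Theory.
Export numFieldNormedType.Exports.

Set Implicit Arguments.
Unset Strict Implicit.
Unset Printing Implicit Defensive.

Local Open Scope classical_set_scope.
Local Open Scope ring_scope.

Notation site d := 'rV[int]_d.

Definition nn d (i j : site d) : bool :=
  \sum_(k < d) `|i 0 k - j 0 k| == 1.

Definition config (d : nat) : Type := prod_topology (fun _ : site d => bool).
HB.instance Definition _ d := Pointed.on (config d).
HB.instance Definition _ d := Topological.on (config d).
(* Borel sigma-algebra of the product topology *)
HB.instance Definition _ d :=
  Measurable.copy (config d) (g_sigma_algebraType (@open (config d))).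

(* The cylinders are a generating pi-system, so this determines mu. *)
Definition bernoulli_product (R : realType) d (p : R)
    (mu : probability (config d) R) : Prop :=
  forall (L : {fset site d}) (zeta : {ffun L -> bool}),
    mu [set w : config d | forall i : L, w (val i) = zeta i] =
    (\prod_(i : L) (if zeta i then p else 1 - p))%:E.

Definition thin d (w : config d) : config d :=
  fun i => w i && `[< forall j, nn i j -> w j = false >].

(* T(Omega), with the subspace topology of config d *)
Definition tconfig (d : nat) : Type := set_type (range (@thin d)).
HB.instance Definition _ d := Topological.on (tconfig d).

(* The thinning map with codomain its range *)
Definition thinning d (w : config d) : tconfig d :=
  exist _ (thin w) (mem_set (imageT (@thin d) w)).

HB.instance Definition _ d := isPointed.Build (tconfig d) (thinning point).
(* Borel sigma-algebra of the subspace topology *)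
HB.instance Definition _ d :=
  Measurable.copy (tconfig d) (g_sigma_algebraType (@open (tconfig d))).

Definition spin d (w : tconfig d) : site d -> bool := val w.

Lemma finite_nn d (i : site d) : finite_set [set j | nn i j].
Proof.
pose f (g : {ffun 'I_d -> 'I_3}) : site d := \row_k (i 0 k + (g k : nat)%:Z - 1).
apply: (@sub_finite_set _ _ (f @` setT)); last exact/finite_image/finite_finset.
move=> j /eqP ij.
have ijk k : `|i 0 k - j 0 k| <= 1 by rewrite -ij (bigD1 k)//= lerDl sumr_ge0.
exists [ffun k => inord (absz (j 0 k - i 0 k + 1))] => //.
apply/rowP => k; rewrite mxE ffunE.
have := ijk k; rewrite ler_norml => /andP[h1 h2].
have h0 : 0 <= j 0 k - i 0 k + 1 by lia.
rewrite inordK; last by lia.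
by rewrite gez0_abs//; lia.
Qed.

Lemma config_near d (w : config d) (i : site d) :
  \forall w' \near w, (w' : config d) i = w i.
Proof.
have : (fun w' : config d => w' i) @ w --> w i.
  exact: (@proj_continuous _ (fun _ : site d => bool) i w).
by move/(_ [set w i]); apply; rewrite nbhs_principalE//; exact/principal_filterP.
Qed.

Lemma thin_continuous d : continuous (@thin d).
Proof.
move=> w; apply/cvg_sup => i.
apply: (@continuous_comp_initial _ (config d) bool (fun v => v i)).
move=> {}w; apply: cvg_near_cst.
have [D DE] := finite_fsetP.1 (finite_nn i).
have Dw : \forall w' \near w,
    (\bigcap_(j in [set` D]) [set v : config d | v j = w j]) w'.
  by apply: filter_bigI => j _; exact: config_near.
near=> w'.
have wi : w' i = w i by near: w'; exact: config_near.
have wD j : nn i j -> w' j = w j.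
  have : (\bigcap_(j in [set` D]) [set v : config d | v j = w j]) w' by near: w'.
  rewrite -DE => /[swap] ij; exact.
rewrite /= /thin wi; congr (_ && _); apply: asbool_equiv_eq.
by split=> h j ij; [rewrite -wD|rewrite wD] => //; exact: h.
Unshelve. all: by end_near. Qed.

Lemma thinning_continuous d : continuous (@thinning d).
Proof.
apply: (@continuous_comp_initial (tconfig d) (config d) (config d) set_val).
exact: thin_continuous.
Qed.

Lemma measurable_thinning d : measurable_fun setT (@thinning d).
Proof.
apply: (@measurability _ _ _ _ _ _ (@open (tconfig d))) => // _ [B oB <-].
rewrite setTI; apply: sub_sigma_algebra.
by move/continuousP: (@thinning_continuous d); exact.
Qed.

HB.instance Definition _ d :=
  isMeasurableFun.Build _ _ _ _ (@thinning d) (@measurable_thinning d).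

(* The law of thinning d under mu, as a probability on tconfig d *)
Definition thinned_measure (R : realType) d (mu : probability (config d) R) :
  probability (tconfig d) R := distribution mu (@thinning d).

Section specification.
Variables (R : realType) (d : nat).
Implicit Type g : {fset site d} -> R.-pker (tconfig d) ~> (tconfig d).
Local Open Scope ereal_scope.

Definition determined_in (L : {fset site d}) (A : set (tconfig d)) : Prop :=
  forall w w', {in L, spin w =1 spin w'} -> A w -> A w'.

Definition depends_outside g : Prop :=
  forall L A, measurable A -> determined_in L A ->
  forall w w', (forall i, i \notin L -> spin w i = spin w' i) ->
  g L w A = g L w' A.

Definition proper g : Prop :=
  forall L w, g L w [set w' | forall i, i \notin L -> spin w' i = spin w i] = 1.

Definition consistent g : Prop :=
  forall L D, (L `<=` D)%fset -> forall A, measurable A -> forall w,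
  \int[g D w]_w' g L w' A = g D w A.

Definition specification g : Prop :=
  [/\ depends_outside g, proper g & consistent g].

Definition quasilocal g : Prop :=
  forall (L : {fset site d}) (zeta : {ffun L -> bool}),
  continuous (fun w : tconfig d =>
    g L w [set w' | forall i : L, spin w' (val i) = zeta i]).

Definition DLR g (mu : probability (tconfig d) R) : Prop :=
  forall L A, measurable A -> \int[mu]_w g L w A = mu A.

Definition gibbs (mu : probability (tconfig d) R) : Prop :=
  exists g, [/\ specification g, quasilocal g & DLR g mu].

End specification.

Definition pcd (R : realType) (d : nat) : R :=
  let D : R := d%:R in
  inf [set p : R | 0 < p < 1 /\
    2 * (D - 1) * (D - 2) * (1 - p ^+ 2) + 4 * (D - 1) * p * (1 - p)
    + 2 * ((1 - p) / (1 - p * (1 - p))) + 6 * (D - 1) * (1 - p) < 1].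

(* Main.v *)
From HB Require Import structures.
Require Import Defs.
From mathcomp Require Import measurable_realfun zify ring lra.

(** Given the thinned configuration, the original one is known on the ones of
    the thinned configuration (ones) and next to them (zeros). At all other
    sites it is Bernoulli conditioned on having no isolated ones, for a
    constraint graph that depends on the thinned configuration. If this
    conditioned field forgets its far away part at a rate that is uniform in
    the graph, the conditional probabilities of the thinned measure in finite
    windows converge uniformly as the window grows, and the limits form a
    quasilocal specification.

    Uniform mixing rests on a recursion for the influence of a single clause
    (site k is not an isolated one) on a local average. Write q = 1 - p.
    Removing the clause at i brings back the configurations with an isolated
    one at i. If i has a available neighbours, their weight is p q^a relative
    to a system without the star of i, against at least p + q^(a+1) for all
    configurations satisfying the other clauses (avg_clause). Detaching the
    star of i in turn costs at most 2 d a influences of clauses at distance at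
    most two (avg_star). Hence the influence contracts as soon as
      2 d a p q^a < p + q^(a+1) - p q^a   for 1 <= a <= 2 d,
    with a margin uniform in a (subcritical), and it then decays exponentially
    in the distance (clause_influence). As the lattice grows polynomially, the
    total influence of all far away clauses is small (avg_mixing).

    The contraction holds for small p because isolated ones are rare, and for
    large p because isolated ones need zeros around them. In the second case
    the worst number of neighbours is a = 1, for which the condition is
    2 d p q < 1 - 2 p q; the inequality defining the threshold is stronger
    (pcd_expr_lt1), and the threshold is at least 1/2.

    Flipping a one of the thinned configuration to zero relates the weights of
    two patterns to a local average of the conditioned field
    (cyl_weight_ratio), which turns mixing into uniform convergence of the
    conditional weights (cond_weight_rate). Properness, consistency and the DLR
    equations pass to the limit through the symmetry of the finite-window
    weights (gibbs_of_weights). For p = 0 and p = 1 the thinned measure is the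
    Dirac mass at zero (endpoint_gibbs). *)

Set Implicit Arguments.
Unset Strict Implicit.
Unset Printing Implicit Defensive.

Local Open Scope classical_set_scope.
Local Open Scope fset_scope.
Local Open Scope ring_scope.

(** * Finite Bernoulli sums *)

Section bernoulli_sum.
Variables (R : realType) (K : choiceType) (p : R).
Implicit Types (V A X Y : {fset K}) (f g : {fset K} -> R) (j : K).

(** The configurations of a finite set V of independent sites are encoded as the
    sets X of their ones, so this is the expectation of f. *)
Definition bern V f : R :=
  \sum_(X <- fpowerset V) p ^+ #|` X| * (1 - p) ^+ #|` V `\` X| * f X.

Lemma eq_bern V f g : (forall X, X `<=` V -> f X = g X) -> bern V f = bern V g.
Proof.
move=> fg; apply: eq_big_seq => X.
by rewrite fpowersetE => XV; rewrite fg.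
Qed.

Lemma bern0 f : bern fset0 f = f fset0.
Proof. by rewrite /bern fpowerset0 big_seq_fset1 fsetD0 cardfs0 !mul1r. Qed.

Lemma bernU1 j V f : j \notin V ->
  bern (j |` V) f = (1 - p) * bern V f + p * bern V (fun X => f (j |` X)).
Proof.
move=> jV.
have jX X : X \in fpowerset V -> j \notin X.
  by rewrite fpowersetE => XV; apply: contra jV => /(fsubsetP XV).
have -> : bern (j |` V) f = \sum_(X <- fpowerset V ++ [seq j |` X | X <- fpowerset V])
    p ^+ #|` X| * (1 - p) ^+ #|` (j |` V) `\` X| * f X.
  apply: perm_big; apply: uniq_perm; first exact: fset_uniq.
    rewrite cat_uniq fset_uniq /=; apply/andP; split.
      apply/hasPn => _ /mapP[Y /jX jY ->]; apply/negP => /jX.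
      by rewrite fset1U1.
    rewrite map_inj_in_uniq ?fset_uniq// => X Y /jX jX' /jX jY XY.
    by rewrite -(fsetU1K jX') XY fsetU1K.
  move=> X; rewrite mem_cat !fpowersetE; apply/idP/orP.
    move=> XV; have [jX'|jX'] := boolP (j \in X).
      right; apply/mapP; exists (X `\ j) => /=; last by rewrite fsetD1K.
      by rewrite fpowersetE fsubDset.
    left; apply/fsubsetP => x xX; have := fsubsetP XV x xX.
    by rewrite !inE => /orP[/eqP xj|//]; rewrite -xj xX in jX'.
  case=> [XV|/mapP[Y /= + ->]].
    by apply: fsubset_trans XV _; exact: fsubsetU1.
  by rewrite fpowersetE => YV; exact: fsetUS.
rewrite big_cat big_map /= /bern !mulr_sumr; congr (_ + _).
  apply: eq_big_seq => X /jX {}jX.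
  rewrite fsetDUl (_ : [fset j] `\` X = [fset j]); last first.
    by apply/fsetP => x; rewrite !inE; case: eqP => [->|]; rewrite ?jX ?andbF.
  by rewrite cardfsU1 !inE (negbTE jV) andbF /= exprS; ring.
apply: eq_big_seq => X /jX {}jX.
rewrite cardfsU1 jX (_ : (j |` V) `\` (j |` X) = V `\` X).
  by rewrite add1n exprS; ring.
apply/fsetP => x; rewrite !inE.
by case: eqP => [->|]//=; rewrite (negbTE jV) andbF.
Qed.

(** Disjoint blocks of sites are independent. All later manipulations of
    expectations are instances of this one. *)
Lemma bern_fubini A V f : [disjoint A & V] ->
  bern (A `|` V) f = bern A (fun X => bern V (fun Y => f (X `|` Y))).
Proof.
elim/finSet_rect: A f => A IH f AV.
have [->|[j jA]] := fset_0Vmem A.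
  by rewrite fset0U bern0; apply: eq_bern => X _; rewrite fset0U.
have jV : j \notin V by move/fdisjointP : AV; apply.
have AE : j |` (A `\ j) = A by rewrite fsetD1K.
have jAj : j \notin A `\ j by rewrite !inE eqxx.
have dj : [disjoint A `\ j & V] by apply: fdisjointWl AV; exact: fsubD1set.
have pj : A `\ j `<` A by rewrite fproperD1.
rewrite -{1}AE -fsetUA bernU1 ?inE ?(negbTE jV) ?eqxx//.
rewrite !IH// -[in RHS]AE bernU1//; congr (_ + _ * _).
by apply: eq_bern => X _; apply: eq_bern => Y _; rewrite fsetUA.
Qed.

Lemma bernD V f g : bern V (fun X => f X + g X) = bern V f + bern V g.
Proof. by rewrite /bern -big_split; apply: eq_bigr => X _; rewrite mulrDr. Qed.

Lemma bernZ V c f : bern V (fun X => c * f X) = c * bern V f.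
Proof. by rewrite /bern mulr_sumr; apply: eq_bigr => X _; rewrite mulrCA. Qed.

Lemma bernB V f g : bern V (fun X => f X - g X) = bern V f - bern V g.
Proof.
rewrite bernD; congr (_ + _); rewrite -mulN1r -bernZ.
by apply: eq_bern => X _; rewrite mulN1r.
Qed.

Lemma bern_cst V c : bern V (fun=> c) = c.
Proof.
elim/finSet_rect: V => V IH.
have [->|[j jV]] := fset_0Vmem V; first by rewrite bern0.
rewrite -(fsetD1K jV) bernU1 ?inE ?eqxx// !IH ?fproperD1//; ring.
Qed.

Lemma bern_empty A c : bern A (fun X => (X == fset0)%:R * c) = (1 - p) ^+ #|` A| * c.
Proof.
rewrite /bern (bigD1_seq fset0)/= ?fpowersetE ?fsub0set ?fset_uniq//.
rewrite big1 ?addr0 ?eqxx ?fsetD0 ?cardfs0 ?mul1r//.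
by move=> X /negbTE ->; rewrite mul0r mulr0.
Qed.

Lemma bern_full A c : bern A (fun X => (X == A)%:R * c) = p ^+ #|` A| * c.
Proof.
rewrite /bern (bigD1_seq A)/= ?fpowersetE ?fsubset_refl ?fset_uniq//.
rewrite big1 ?addr0 ?eqxx ?fsetDv ?cardfs0 ?mul1r ?mulr1//.
by move=> X /negbTE ->; rewrite mul0r mulr0.
Qed.

Lemma bern_split A V f : A `<=` V ->
  bern V f = bern A (fun X => bern (V `\` A) (fun Y => f (X `|` Y))).
Proof.
move=> AV; rewrite -{1}(fsetID A V) (fsetIidPr AV) bern_fubini//.
by apply/fdisjointP => x xA; rewrite !inE xA.
Qed.

(** Sites conditioned to be zero leave the system: X disjoint from A is a
    configuration of V minus A. *)
Lemma bern_zero A V f : A `<=` V ->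
  bern V (fun X => [disjoint X & A]%:R * f X) = (1 - p) ^+ #|` A| * bern (V `\` A) f.
Proof.
move=> AV; rewrite (bern_split _ AV) -bern_empty; apply: eq_bern => X XA.
rewrite -bernZ; apply: eq_bern => Y; rewrite fsubsetD => /andP[YV YA].
rewrite fdisjointUX YA andbT; have [->|X0] := eqVneq X fset0.
  by rewrite fdisjoint0X fset0U.
suff /negbTE -> : ~~ [disjoint X & A]%fset by rewrite !mul0r.
by rewrite -fsetI_eq0 (fsetIidPl XA).
Qed.

Lemma bern_one A V f : A `<=` V ->
  bern V (fun X => (A `<=` X)%:R * f X) =
  p ^+ #|` A| * bern (V `\` A) (fun X => f (A `|` X)).
Proof.
move=> AV; rewrite (bern_split _ AV) -bern_full; apply: eq_bern => X XA.
rewrite -bernZ; apply: eq_bern => Y; rewrite fsubsetD => /andP[YV YA].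
have -> : (A `<=` X `|` Y) = (X == A).
  rewrite eqEfsubset XA /=; apply/fsubsetP/fsubsetP => AX x xA; last first.
    by rewrite inE AX.
  have := AX x xA; rewrite inE => /orP[//|xY].
  by move/fdisjointP : YA => /(_ _ xY); rewrite xA.
by case: eqP => [->//|]; rewrite !mul0r.
Qed.

Lemma bern_indep A V f : A `<=` V -> (forall X, X `<=` V -> f X = f (X `\` A)) ->
  bern V f = bern (V `\` A) f.
Proof.
move=> AV fA; rewrite (bern_split _ AV) -[RHS](bern_cst A); apply: eq_bern => X XA.
apply: eq_bern => Y; rewrite fsubsetD => /andP[YV YA].
rewrite fA ?fsubUset ?YV ?(fsubset_trans XA)//.
by rewrite fsetDUl (eqP (_ : X `\` A == fset0)) ?fsetD_eq0// fset0U (fsetDidPl _ _ YA).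
Qed.

Section nonneg.
Hypotheses (p0 : 0 <= p) (p1 : p <= 1).

Lemma bern_le V f g : (forall X, X `<=` V -> f X <= g X) -> bern V f <= bern V g.
Proof.
move=> fg; rewrite /bern !big_seq; apply: ler_sum => X.
rewrite fpowersetE => XV; apply: ler_wpM2l (fg _ XV).
by rewrite mulr_ge0// exprn_ge0// subr_ge0.
Qed.

Lemma bern_ge0 V f : (forall X, X `<=` V -> 0 <= f X) -> 0 <= bern V f.
Proof. by move=> f0; rewrite -[leLHS](bern_cst V); exact: bern_le. Qed.

End nonneg.

End bernoulli_sum.

(** * Bernoulli sites conditioned on having no isolated ones *)

Section no_isolated_ones.
Variables (R : realType) (K : choiceType) (nb : K -> {fset K}).
Hypothesis nb_sym : forall i j, (j \in nb i) = (i \in nb j).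
Hypothesis nb_irr : forall i, i \notin nb i.
Implicit Types (V A C S X Y : {fset K}) (f g : {fset K} -> R) (i j k : K).

(** The clause at k forbids k to be an isolated one. Only the clauses at the
    sites of C are imposed; keeping the set of clauses separate from the set of
    sites makes it possible to add and remove clauses one at a time. *)
Definition sat C X : bool :=
  all (fun k => (k \in X) ==> ~~ [disjoint nb k & X]%fset) C.

Lemma satP C X :
  reflect (forall k, k \in C -> k \in X -> exists2 j, j \in nb k & j \in X)
          (sat C X).
Proof.
apply: (iffP allP) => [h k kC kX|h k kC].
  move: (h k kC); rewrite kX /= => /fdisjointP nd.
  apply: contrapT => ne; apply: nd => j jk; apply/negP => jX.
  by apply: ne; exists j.
apply/implyP => kX; have [j jk jX] := h k kC kX.
by apply/negP => /fdisjointP/(_ j jk); rewrite jX.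
Qed.

Definition star i := i |` nb i.

Definition depends_on S g := forall X, g X = g (X `&` S).

Variable p : R.
Hypotheses (p0 : 0 <= p) (p1 : p < 1).
Let q := 1 - p.

Let q0 : 0 < q. Proof. by rewrite /q subr_gt0. Qed.
Let p1' : p <= 1. Proof. exact: ltW. Qed.

Definition wsum V C g : R := bern p V (fun X => (sat C X)%:R * g X).
Definition total V C : R := wsum V C (fun=> 1).
Definition avg V C g : R := wsum V C g / total V C.

Lemma total_gt0 V C : 0 < total V C.
Proof.
apply: (@lt_le_trans _ _ (q ^+ #|` V| * 1)); first by rewrite mulr1 exprn_gt0.
rewrite -bern_empty; apply: bern_le => // X _.
rewrite !mulr1; have [->|] := eqVneq X fset0; last by rewrite ler0n.
by have -> : sat C fset0 by apply/satP.
Qed.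

Lemma wsum_avg V C g : wsum V C g = total V C * avg V C g.
Proof. by rewrite /avg mulrC divfK// gt_eqF// total_gt0. Qed.

Lemma avg_ge0_le1 V C g : (forall X, 0 <= g X <= 1) -> 0 <= avg V C g <= 1.
Proof.
move=> g01; apply/andP; split.
  apply: divr_ge0; last exact/ltW/total_gt0.
  by apply: bern_ge0 => // X _; rewrite mulr_ge0//; case/andP: (g01 X).
rewrite ler_pdivrMr ?total_gt0// mul1r; apply: bern_le => // X _.
by rewrite ler_wpM2l//; case/andP: (g01 X).
Qed.

(** If i is an isolated one, its neighbours are zeros: their clauses hold, and
    neither i nor its neighbours help the clause of any other site. *)
Lemma sat_outside_star C X i : i \notin C -> [disjoint X & star i] ->
  sat C (i |` X) = sat (C `\` star i) X.
Proof.
move=> iC /fdisjointP XN.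
apply/satP/satP => h k.
  rewrite !inE negb_or => /andP[/andP[ki kn] kC] kX.
  have [j jk] := h k kC (fset1Ur _ kX).
  rewrite !inE => /orP[/eqP ji|jX]; last by exists j.
  by rewrite ji -nb_sym (negbTE kn) in jk.
move=> kC; rewrite !inE => /orP[/eqP ki|kX]; first by rewrite ki (negbTE iC) in kC.
have kN := XN k kX.
have [|j jk jX] := h k _ kX; first by rewrite inE kN.
by exists j => //; rewrite fset1Ur.
Qed.

Lemma depends_onD S g X A : depends_on S g -> [disjoint A & S] ->
  g (X `\` A) = g X.
Proof.
move=> gS /fdisjointP AS; rewrite gS [RHS]gS; congr g; apply/fsetP => x.
rewrite !inE; case: (boolP (x \in A)) => //= xA.
by rewrite (negbTE (AS x xA)) andbF.
Qed.

Lemma depends_onU S g X A : depends_on S g -> [disjoint A & S] ->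
  g (A `|` X) = g X.
Proof.
move=> gS AS; rewrite -(depends_onD _ gS AS) -[RHS](depends_onD _ gS AS).
by congr g; apply/fsetP => x; rewrite !inE; case: (x \in A).
Qed.

Lemma star_setI V i : i \in V -> V `&` star i = i |` (nb i `&` V).
Proof.
move=> iV; apply/fsetP => x; rewrite !inE; case: eqP => [->|] /=.
  by rewrite iV.
by rewrite andbC.
Qed.

Lemma fsetD_star V i : V `\` star i = (V `\ i) `\` (nb i `&` V).
Proof.
apply/fsetP => x; rewrite !inE; case: (x \in V); rewrite ?andbF//= !andbT.
by rewrite negb_or andbC.
Qed.

(** The two sums differ by the configurations in which i is an isolated one.
    Outside the star of i, such a configuration is an arbitrary one of a smaller
    system of the same kind. *)
Lemma wsum_clause V C S g i : i \in V -> i \notin C ->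
  depends_on S g -> [disjoint star i & S] ->
  wsum V C g - wsum V (i |` C) g =
  p * q ^+ #|` nb i `&` V| * wsum (V `\` star i) (C `\` star i) g.
Proof.
move=> iV iC gS iS; rewrite /wsum -bernB.
transitivity (bern p V (fun X => ([fset i] `<=` X)%:R *
    ([disjoint X & nb i `&` V]%:R * ((sat C X)%:R * g X)))).
  apply: eq_bern => X XV.
  have -> : sat (i |` C) X = sat C X && ((i \in X) ==> ~~ [disjoint nb i & X]%fset).
    apply/satP/andP => [h|[/satP h1 h2] k].
      split; first by apply/satP => k kC; apply: h; rewrite fset1Ur.
      apply/implyP => iX; have [j ij jX] := h i (fset1U1 _ _) iX.
      by apply/negP => /fdisjointP/(_ j ij); rewrite jX.
    rewrite !inE => /orP[/eqP ->|kC]; last exact: h1.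
    move=> iX; move: h2; rewrite iX /= => /fdisjointP nd.
    apply: contrapT => ne; apply: nd => j jk; apply/negP => jX.
    by apply: ne; exists j.
  have -> : [disjoint X & nb i `&` V] = [disjoint nb i & X].
    rewrite fdisjoint_sym; apply/fdisjointP/fdisjointP => h j.
      move=> ij; apply/negP => jX; move: (h j); rewrite inE ij (fsubsetP XV _ jX).
      by rewrite jX => /(_ isT).
    by rewrite inE => /andP[/h].
  rewrite fsub1set; case: (sat C X); case: (i \in X); case: [disjoint nb i & X]%fset;
  by rewrite /= ?(mul0r, mul1r, subr0, subrr).
rewrite bern_one ?fsub1set// cardfs1 expr1 -mulrA; congr (_ * _).
transitivity (bern p (V `\ i) (fun X =>
    [disjoint X & nb i `&` V]%:R * ((sat C (i |` X))%:R * g X))).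
  apply: eq_bern => X XV; rewrite (depends_onU _ gS); last first.
    by apply: fdisjointWl iS; rewrite fsub1set fset1U1.
  congr (_%:R * _); rewrite fdisjointU1X inE (negbTE (nb_irr i)) /=.
  by [].
rewrite bern_zero -?fsetD_star; last first.
  apply/fsubsetP => j; rewrite !inE => /andP[ij ->]; rewrite andbT.
  by apply: contraNneq (nb_irr i) => ji; rewrite -[X in X \in _]ji.
congr (_ * _); apply: eq_bern => X; rewrite fsubsetD => /andP[XV XN].
by rewrite sat_outside_star.
Qed.

(** The configurations with an isolated one at i are compared with two disjoint
    families that satisfy all clauses: those with a one at i, whatever its
    neighbours do, and those with zeros on the whole star of i. *)
Lemma total_lower V C i : i \in V -> i \notin C ->
  (p + q ^+ (#|` nb i `&` V|).+1) * total (V `\` star i) (C `\` star i) <= total V C.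
Proof.
move=> iV iC; rewrite /total /wsum.
pose h X : R := (sat (C `\` star i) (X `\` star i))%:R.
have hE : bern p (V `\` star i) (fun X => (sat (C `\` star i) X)%:R * 1) =
          bern p (V `\` star i) h.
  apply: eq_bern => X; rewrite fsubsetD => /andP[_ XN].
  by rewrite mulr1 /h (fsetDidPl _ _ XN).
rewrite hE mulrDl.
have -> : p * bern p (V `\` star i) h = bern p V (fun X => ([fset i] `<=` X)%:R * h X).
  rewrite bern_one ?fsub1set// cardfs1 expr1 fsetD_star; congr (_ * _).
  rewrite (_ : bern p (V `\ i) (fun X => h (i |` X)) = bern p (V `\ i) h); last first.
    apply: eq_bern => X _; rewrite /h; congr (sat _ _)%:R; apply/fsetP => x.
    by rewrite !inE; case: (x == i).
  apply/esym/bern_indep.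
    apply/fsubsetP => j; rewrite !inE => /andP[ij ->]; rewrite andbT.
    by apply: contraNneq (nb_irr i) => ji; rewrite -[X in X \in _]ji.
  move=> X XV; rewrite /h; congr (sat _ _)%:R; apply/fsetP => x; rewrite !inE.
  case: (x == i) => //=; case: (x \in nb i) => //=.
have -> : q ^+ (#|` nb i `&` V|).+1 * bern p (V `\` star i) h =
          bern p V (fun X => [disjoint X & V `&` star i]%:R * h X).
  rewrite bern_zero ?fsubsetIl// star_setI//.
  have iN : i \notin nb i `&` V by rewrite inE (negbTE (nb_irr i)).
  rewrite cardfsU1 iN add1n; congr (_ * bern _ _ _).
  by rewrite fsetD_star fsetDDl.
rewrite -bernD; apply: bern_le => // X XV; rewrite -mulrDl mulr1 /h.
have [/satP sX|_] := boolP (sat (C `\` star i) (X `\` star i)); last by rewrite mulr0.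
have sk k : k \in C -> k \in X -> k \notin star i -> exists2 j, j \in nb k & j \in X.
  move=> kC kX kN; have [||j jk] := sX k; rewrite 1?inE ?kN//.
  by rewrite inE => /andP[_ jX]; exists j.
rewrite mulr1 fsub1set; have [iX|iX] := boolP (i \in X).
  have -> : [disjoint X & V `&` star i] = false.
    apply/negbTE/negP => /fdisjointP/(_ i iX).
    by rewrite star_setI// fset1U1.
  suff -> : sat C X by rewrite addr0.
  apply/satP => k kC kX; have [|/sk] := boolP (k \in star i); last exact.
  rewrite !inE => /orP[/eqP ki|ki]; first by rewrite ki (negbTE iC) in kC.
  by exists i => //; rewrite nb_sym.
rewrite add0r; have [/fdisjointP XN|_] := boolP [disjoint X & V `&` star i]%fset.
  suff -> : sat C X by [].
  apply/satP => k kC kX; apply: sk => //; have := XN k kX.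
  by rewrite inE (fsubsetP XV _ kX).
by [].
Qed.

Lemma influence_denom_gt0 a : 0 < p + q ^+ a.+1 - p * q ^+ a.
Proof.
have qa : 0 < q ^+ a.+1 by rewrite exprn_gt0.
have qb : q ^+ a <= 1 by rewrite exprn_ile1 ?(ltW q0)// /q gerBl.
have : p * q ^+ a <= p * 1 by rewrite ler_wpM2l.
lra.
Qed.

(** Removing the clause at i mixes in, with odds at most the displayed
    fraction, the system in which i is an isolated one. If i has a neighbour in
    V, these odds are small both for p near 0 and for p near 1. *)
Lemma avg_clause V C S g i : i \in V -> i \notin C ->
  depends_on S g -> [disjoint star i & S] ->
  let w := p * q ^+ #|` nb i `&` V| in
  `|avg V C g - avg V (i |` C) g| <=
  w / (p + q ^+ (#|` nb i `&` V|).+1 - w) *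
  `|avg V C g - avg (V `\` star i) (C `\` star i) g|.
Proof.
move=> iV iC gS iS /=; set a := #|` _|; set w := p * q ^+ a.
set V' := V `\` star i; set C' := C `\` star i.
have z0 := total_gt0 V' C'; have Z0 := total_gt0 V C; have Z1 := total_gt0 V (i |` C).
have e1 : total V C - total V (i |` C) = w * total V' C'.
  by apply: (@wsum_clause _ _ S) => // X.
have e2 : wsum V C g - wsum V (i |` C) g = w * wsum V' C' g.
  exact: (@wsum_clause _ _ S).
have low : (p + q ^+ a.+1) * total V' C' <= total V C by exact: total_lower.
have w0 : 0 <= w by rewrite mulr_ge0// exprn_ge0// ltW.
have den0 : 0 < p + q ^+ a.+1 - w := influence_denom_gt0 a.
have -> : avg V C g - avg V (i |` C) g =
    (w * total V' C' / total V (i |` C)) * (avg V' C' g - avg V C g).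
  have e3 : wsum V (i |` C) g = total V C * avg V C g - w * (total V' C' * avg V' C' g).
    by rewrite -!wsum_avg -e2; ring.
  have -> : avg V (i |` C) g =
      (total V C * avg V C g - w * (total V' C' * avg V' C' g)) / total V (i |` C).
    by rewrite [LHS]/avg e3.
  have -> : total V C = total V (i |` C) + w * total V' C' by rewrite -e1; ring.
  by field; rewrite gt_eqF.
rewrite normrM distrC ler_wpM2r// ger0_norm; last first.
  by apply: divr_ge0; [apply: mulr_ge0 => //; exact: ltW|exact: ltW].
rewrite ler_pdivrMr// [leRHS]mulrAC ler_pdivlMr// -mulrA ler_wpM2l//.
have -> : total V (i |` C) = total V C - w * total V' C' by rewrite -e1; ring.
rewrite mulrC mulrBl lerB//.
Qed.

(** Without its own clause, the site j acts on the rest only by satisfying the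
    clauses of its neighbours, which it does when it is a one. *)
Lemma wsum_site V C S g j : j \in V -> j \notin C ->
  depends_on S g -> j \notin S ->
  wsum V C g = q * wsum (V `\ j) C g + p * wsum (V `\ j) (C `\` nb j) g.
Proof.
move=> jV jC gS jS; rewrite /wsum -{1}(fsetD1K jV) bernU1 ?inE ?eqxx//.
congr (_ + _ * _); apply: eq_bern => X XV.
rewrite (depends_onU _ gS) ?fdisjoint1X//; congr ((nat_of_bool _)%:R * _).
apply/satP/satP => h k.
  rewrite inE => /andP[kn kC] kX.
  have [l lk] := h k kC (fset1Ur _ kX).
  rewrite !inE => /orP[/eqP lj|lX]; last by exists l.
  by rewrite lj -nb_sym (negbTE kn) in lk.
move=> kC; rewrite !inE => /orP[/eqP kj|kX]; first by rewrite kj (negbTE jC) in kC.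
have [kn|kn] := boolP (k \in nb j).
  by exists j; rewrite ?fset1U1// nb_sym.
have [|l lk lX] := h k _ kX; first by rewrite inE kn.
by exists l => //; rewrite fset1Ur.
Qed.

(** By the decomposition according to the value of j, the average is a convex
    combination of the two averages on the right, so deleting a site costs no
    more than removing the clauses of its neighbours. *)
Lemma avg_site V C S g j : j \in V -> j \notin C ->
  depends_on S g -> j \notin S ->
  `|avg V C g - avg (V `\ j) C g| <=
  `|avg (V `\ j) (C `\` nb j) g - avg (V `\ j) C g|.
Proof.
move=> jV jC gS jS.
set V' := V `\ j; set C' := C `\` nb j.
have z0 := total_gt0 V' C'; have z1 := total_gt0 V' C; have Z0 := total_gt0 V C.
have eZ : total V C = q * total V' C + p * total V' C' by exact: (@wsum_site _ _ S).
have eW : wsum V C g = q * (total V' C * avg V' C g) + p * (total V' C' * avg V' C' g).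
  by rewrite -!wsum_avg; exact: (@wsum_site _ _ S).
have -> : avg V C g - avg V' C g =
    (p * total V' C' / total V C) * (avg V' C' g - avg V' C g).
  have -> : avg V C g =
      (q * (total V' C * avg V' C g) + p * (total V' C' * avg V' C' g)) / total V C.
    by rewrite -eW.
  have ZC : total V C != 0 by rewrite gt_eqF.
  have {2}-> : avg V' C g = avg V' C g * (q * total V' C + p * total V' C') / total V C.
    by rewrite -eZ mulfK.
  by field.
have w0 : 0 <= p * total V' C' by rewrite mulr_ge0// ltW.
rewrite normrM ler_piMl// ger0_norm ?divr_ge0 ?(ltW Z0)//.
by rewrite ler_pdivrMr// mul1r eZ lerDr mulr_ge0// ltW.
Qed.

Lemma avg_restrict V C S g A : A `<=` V -> depends_on S g -> [disjoint A & S] ->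
  (forall k, k \in C -> [disjoint star k & A]) ->
  avg V C g = avg (V `\` A) C g.
Proof.
move=> AV gS AS CA.
have sA X : sat C (X `\` A) = sat C X.
  apply/satP/satP => h k kC kX; have /fdisjointP kA := CA k kC.
    have [|j jk] := h k kC; first by rewrite inE kX (kA k (fset1U1 _ _)).
    by rewrite inE => /andP[_ jX]; exists j.
  have [j jk jX] := h k kC (fsubsetP (fsubsetDl _ _) _ kX).
  by exists j => //; rewrite inE jX andbT; apply: kA; rewrite fset1Ur.
rewrite /avg /total /wsum; congr (_ / _); apply: bern_indep => // X XV; rewrite ?sA//.
by rewrite (depends_onD _ gS AS).
Qed.

Section removing_clauses.
Variables (V S : {fset K}) (g : {fset K} -> R) (b : K -> R) (P : pred K).
Hypothesis eff : forall C i, C `<=` V -> i \in V -> i \notin C -> P i ->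
  `|avg V C g - avg V (i |` C) g| <= b i.

Lemma avg_clauses C A : C `<=` V -> A `<=` C -> {in A, forall i, P i} ->
  `|avg V (C `\` A) g - avg V C g| <= \sum_(i <- A) b i.
Proof.
move=> CV; elim/finSet_rect: A => A IH AC AP.
have [->|[i iA]] := fset_0Vmem A.
  by rewrite fsetD0 subrr normr0 big_seq_fset0.
rewrite (big_fsetD1 i)//= -[leLHS](_ : `|(avg V (C `\` A) g -
   avg V (C `\` (A `\ i)) g) + (avg V (C `\` (A `\ i)) g - avg V C g)| = _).
  apply: le_trans (ler_normD _ _) (lerD _ _).
    have -> : C `\` (A `\ i) = i |` (C `\` A).
      apply/fsetP => x; rewrite !inE negb_and negbK; case: eqP => //= ->.
      by rewrite (fsubsetP AC).
    apply: eff; rewrite ?inE ?iA ?AP//.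
      by apply: fsubset_trans CV; exact: fsubsetDl.
    by apply: (fsubsetP CV); exact: (fsubsetP AC).
  apply: IH; first exact: fproperD1.
    by apply: fsubset_trans AC; exact: fsubD1set.
  by move=> x; rewrite inE => /andP[_ /AP].
by congr `|_|; ring.
Qed.

End removing_clauses.

Section decay.
Variables (Delta : nat) (l1norm : K -> nat) (kappa : R).
Hypothesis nb_card : forall i, (#|` nb i| <= Delta)%N.
Hypothesis l1norm_nb : forall i j, j \in nb i -> (l1norm i <= l1norm j + 1)%N.
Hypothesis kappa0 : 0 <= kappa.
Hypothesis kappaP : forall a : nat, (a <= Delta)%N ->
  (Delta * a)%:R * (p * q ^+ a) <= kappa * (p + q ^+ a.+1 - p * q ^+ a).
Variables (s : nat) (S : {fset K}) (g : {fset K} -> R).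
Hypothesis g01 : forall X, 0 <= g X <= 1.
Hypothesis gS : depends_on S g.
Hypothesis S_s : {in S, forall x, (l1norm x <= s)%N}.

Lemma avg_dist1 V C V' C' : `|avg V C g - avg V' C' g| <= 1.
Proof.
have /andP[a0 a1] := avg_ge0_le1 V C g01.
have /andP[b0 b1] := avg_ge0_le1 V' C' g01.
by rewrite ler_norml; lra.
Qed.

Lemma avg_clauses_far (l : nat) (e : R) V C A : C `<=` V -> A `<=` C ->
  (forall C i, C `<=` V -> i \in V -> i \notin C -> (l <= l1norm i)%N ->
    `|avg V C g - avg V (i |` C) g| <= e) ->
  {in A, forall i, (l <= l1norm i)%N} ->
  `|avg V (C `\` A) g - avg V C g| <= #|` A|%:R * e.
Proof.
move=> CV AC eff Al.
have -> : #|` A|%:R * e = \sum_(x <- A) e.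
  by rewrite big_const_seq count_predT iter_addr_0 mulr_natl.
exact: (avg_clauses (P := fun i => (l <= l1norm i)%N)).
Qed.

(** One step of the recursion: with a neighbours in V, the star of i can be
    detached by removing at most a clauses at the neighbours, deleting i for
    free, and deleting the neighbours one by one, each at the price of at most
    Delta - 1 clauses. All these clauses are within distance two of i. *)
Lemma avg_star (l : nat) (e : R) V C i : C `<=` V -> i \in V -> i \notin C ->
  (l + 2 <= l1norm i)%N -> (s + 2 <= l1norm i)%N -> 0 <= e ->
  (forall V C i, C `<=` V -> i \in V -> i \notin C -> (l <= l1norm i)%N ->
    `|avg V C g - avg V (i |` C) g| <= e) ->
  `|avg V C g - avg (V `\` star i) (C `\` star i) g| <=
  (Delta * #|` nb i `&` V|)%:R * e.
Proof.
move=> CV iV iC li si e0 eff; set a := #|` _|; set C' := C `\` star i.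
have far1 j : j \in nb i -> (l + 1 <= l1norm j)%N && (s < l1norm j)%N.
  by move=> /l1norm_nb; move: (l1norm i) (l1norm j) li si => x y; lia.
have starS : [disjoint star i & S].
  apply/fdisjointP => j; rewrite !inE => /orP[/eqP ->|/far1/andP[_ sj]].
    by apply/negP => /S_s; rewrite leqNgt (leq_trans _ si)// addn2.
  by apply/negP => /S_s; rewrite leqNgt sj.
have s1 : `|avg V C g - avg V C' g| <= a%:R * e.
  have -> : C' = C `\` (nb i `&` C).
    apply/fsetP => x; rewrite !inE; have [xC|] := boolP (x \in C); last by rewrite !andbF.
    by rewrite !andbT negb_or (contraNneq _ iC)// => <-.
  rewrite distrC; apply: (@le_trans _ _ (#|` nb i `&` C|%:R * e)).
    apply: (@avg_clauses_far l) => //; [exact: fsubsetIr|by move=> D j; exact: eff|].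
    by move=> x; rewrite inE => /andP[/far1/andP[+ _] _]; rewrite addn1 => /ltnW.
  by rewrite ler_wpM2r// ler_nat fsubset_leq_card// fsetIS.
(* i occurs in the clauses of its neighbours only, and these are gone *)
have CN k : k \in C' -> [disjoint star k & [fset i]].
  rewrite fdisjointX1 !inE !negb_or => /andP[/andP[ki kn] _].
  by rewrite eq_sym ki -nb_sym.
have s2 : avg V C' g = avg (V `\ i) C' g.
  apply: (avg_restrict (S := S)); rewrite ?fsub1set ?fdisjoint1X//.
  by move/fdisjointP : starS; apply; exact: fset1U1.
(* i is a neighbour of each j below and has no clause: Delta - 1 clauses at most *)
have s3 B : B `<=` nb i `&` V ->
    `|avg (V `\ i) C' g - avg ((V `\ i) `\` B) C' g| <= (#|` B| * Delta.-1)%:R * e.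
  elim/finSet_rect: B => B IH BV.
  have [->|[j jB]] := fset_0Vmem B; first by rewrite fsetD0 subrr normr0 mulr_ge0.
  have /fsetIP[ji jV] := fsubsetP BV j jB.
  set V1 := (V `\ i) `\` (B `\ j).
  have VE : (V `\ i) `\` B = V1 `\ j.
    by rewrite /V1 [RHS]fsetDDl fsetUC fsetD1K.
  have jne : j != i by apply: contraTneq ji => ->; exact: nb_irr.
  have jV1 : j \in V1 by rewrite !inE eqxx jne jV.
  have jC' : j \notin C' by rewrite !inE ji orbT.
  have jS : j \notin S by move/fdisjointP : starS; apply; rewrite fset1Ur.
  have h1 : `|avg (V `\ i) C' g - avg V1 C' g| <= (#|` B `\ j| * Delta.-1)%:R * e.
    apply: IH; first exact: fproperD1.
    by apply: fsubset_trans BV; exact: fsubD1set.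
  have h2 : `|avg V1 C' g - avg (V1 `\ j) C' g| <= Delta.-1%:R * e.
    apply: le_trans (avg_site jV1 jC' gS jS) _.
    have -> : C' `\` nb j = C' `\` (nb j `&` C').
      apply/fsetP => x; rewrite !inE; have [xC|] := boolP (x \in C); last by rewrite !andbF.
      by case: (x == i); case: (x \in nb i); case: (x \in nb j).
    apply: (@le_trans _ _ (#|` nb j `&` C'|%:R * e)).
      apply: (@avg_clauses_far l).
      - apply/fsubsetP => x; rewrite !inE negb_or => /andP[/andP[xi xn] xC].
        rewrite (fsubsetP CV _ xC) xi negb_and !andbT.
        have -> /= : x != j by apply: contraNneq xn => ->.
        by apply: contra xn => /(fsubsetP BV); rewrite inE => /andP[].
      - exact: fsubsetIr.
      - by move=> D k; exact: eff.
      - move=> x; rewrite inE => /andP[/l1norm_nb xj _].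
        by have /andP[lj _] := far1 _ ji; rewrite -(leq_add2r 1) (leq_trans lj).
    rewrite ler_wpM2r// ler_nat.
    have : nb j `&` C' `<=` nb j `\ i.
      apply/fsubsetP => x; rewrite !inE negb_or => /andP[-> /andP[/andP[-> _] _]].
      by [].
    move=> /fsubset_leq_card /leq_trans; apply.
    have := nb_card j; rewrite (cardfsD1 i (nb j)) -nb_sym ji add1n.
    by case: Delta.
  rewrite VE (cardfsD1 j) jB mulnDl mul1n natrD mulrDl [leRHS]addrC.
  by apply: le_trans (lerD h1 h2); exact: ler_distD.
have := s3 _ (fsubset_refl _); rewrite -fsetD_star -s2 => {}s3.
apply: le_trans (ler_distD (avg V C' g) _ _) (le_trans (lerD s1 s3) _).
rewrite -mulrDl -natrD ler_wpM2r// ler_nat -/a.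
have : (a <= Delta)%N by apply: leq_trans (nb_card i); rewrite fsubset_leq_card// fsubsetIl.
case: Delta => [|D] /=; first by rewrite leqn0 => /eqP ->.
by move=> _; rewrite mulSn mulnC.
Qed.

(** The influence of a distant clause decays exponentially. Each step of the
    recursion moves at most two units closer to the support of the observable
    and gains a factor kappa; when a is zero the step gives influence zero,
    which is why sites left without neighbours do no harm. *)
Lemma clause_influence (k : nat) V C i : C `<=` V -> i \in V -> i \notin C ->
  (2 * k + s + 2 <= l1norm i)%N ->
  `|avg V C g - avg V (i |` C) g| <= kappa ^+ k.
Proof.
elim: k V C i => [|k IH] V C i CV iV iC ki; first by rewrite expr0 avg_dist1.
have ki' : (s + 2 <= l1norm i)%N by move: (l1norm i) ki => x; lia.
have starS : [disjoint star i & S].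
  apply/fdisjointP => j; rewrite !inE => /orP[/eqP ->|/l1norm_nb ij].
    by apply/negP => /S_s; move: (l1norm i) ki' => x; lia.
  by apply/negP => /S_s; move: (l1norm i) (l1norm j) ij ki' => x y; lia.
apply: le_trans (avg_clause iV iC gS starS) _.
set a := #|` _|.
have aD : (a <= Delta)%N by apply: leq_trans (nb_card i); rewrite fsubset_leq_card// fsubsetIl.
have h : `|avg V C g - avg (V `\` star i) (C `\` star i) g| <=
    (Delta * a)%:R * kappa ^+ k.
  apply: (@avg_star (2 * k + s + 2)%N) => //; last exact: exprn_ge0.
  by move: (l1norm i) ki => x; lia.
have den0 := influence_denom_gt0 a.
apply: le_trans (ler_wpM2l _ h) _.
  by rewrite divr_ge0 ?(ltW den0)// mulr_ge0// exprn_ge0// ltW.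
rewrite mulrA [leRHS]exprS ler_wpM2r ?exprn_ge0//.
by rewrite mulrAC ler_pdivrMr// mulrC kappaP.
Qed.

(** Clauses far away are removed at the price of their influences; the sites
    beyond the remaining clauses are then independent of everything. *)
Lemma avg_truncate (r : nat) V C : C `<=` V -> (s <= r)%N ->
  `|avg V C g - avg [fset x in V | (l1norm x <= r)%N] [fset x in C | (l1norm x < r)%N] g|
  <= \sum_(x <- [fset x in C | (r <= l1norm x)%N]) kappa ^+ ((l1norm x - (s + 2))./2).
Proof.
move=> CV sr.
set C1 := [fset x in C | (l1norm x < r)%N].
have C1E : C1 = C `\` [fset x in C | (r <= l1norm x)%N].
  apply/fsetP => x; rewrite !inE /=; case: (x \in C) => //=.
  by rewrite andbT ltnNge.
have -> : [fset x in V | (l1norm x <= r)%N] = V `\` [fset x in V | (r < l1norm x)%N].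
  apply/fsetP => x; rewrite !inE /=; case: (x \in V) => //=.
  by rewrite andbT leqNgt.
rewrite -(avg_restrict (S := S)) => //.
- rewrite C1E distrC.
  apply: (avg_clauses (P := predT)) => //; last exact: fset_sub.
  move=> D i DV iV iD _; have [si|si] := leqP (s + 2) (l1norm i).
    by apply: clause_influence => //; move: (l1norm i) si => x; lia.
  rewrite (eqP (_ : l1norm i - (s + 2) == 0)%N) ?expr0 ?avg_dist1//.
  by rewrite subn_eq0 ltnW.
- exact: fset_sub.
- apply/fdisjointP => x; rewrite !inE /= => /andP[_ rx].
  by apply/negP => /S_s; move: (l1norm x) rx => y; lia.
- move=> k; rewrite !inE /= => /andP[kC kr]; apply/fdisjointP => x.
  rewrite !inE /= negb_and -leqNgt => /orP[/eqP ->|xk]; first by rewrite ltnW ?orbT.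
  apply/orP; right; have : k \in nb x by rewrite nb_sym.
  by move/l1norm_nb; move: (l1norm k) (l1norm x) kr => u v; lia.
Qed.

End decay.

End no_isolated_ones.

(** * The cubic lattice and exponential mixing *)

Section lattice.
Variable d : nat.
Implicit Types (i j : site d) (C : {fset site d}).

Definition nb i : {fset site d} := fset_set [set j | nn i j].

Lemma in_nb i j : (j \in nb i) = nn i j.
Proof.
rewrite in_fset_set; last exact: finite_nn.
by apply/idP/idP => [/set_mem|h]; last exact: mem_set.
Qed.

Lemma nn_sym i j : nn i j = nn j i.
Proof. by rewrite /nn; congr (_ == _); apply: eq_bigr => k _; rewrite distrC. Qed.

Lemma nb_sym i j : (j \in nb i) = (i \in nb j).
Proof. by rewrite !in_nb nn_sym. Qed.

Lemma nb_irr i : i \notin nb i.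
Proof.
rewrite in_nb /nn big1 => [|k _]; last by rewrite subrr normr0.
by [].
Qed.

(** A sum of nonnegative integers is one only if a single term is one and the
    others vanish. *)
Lemma nnE i j : nn i j ->
  exists k, j = i + delta_mx 0 k \/ j = i - delta_mx 0 k.
Proof.
move=> /eqP ij.
have [k ijk] : exists k, i 0 k != j 0 k.
  apply: contrapT => ne; move: ij; rewrite big1// => k _.
  apply/eqP; rewrite normr_eq0 subr_eq0; apply: contrapT => /negP ijk.
  by apply: ne; exists k.
exists k; move: ij; rewrite (bigD1 k)//=.
set s := \sum_(_ < _ | _) _ => ij.
have s0 : 0 <= s by rewrite sumr_ge0.
have {}ijk : 1 <= `|i 0 k - j 0 k| by rewrite -subr_eq0 in ijk; lia.
have se : s = 0 by lia.
have other l : l != k -> j 0 l = i 0 l.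
  move=> lk; move/eqP: se; rewrite psumr_eq0// => /allP/(_ l (mem_index_enum _)).
  by rewrite lk /= normr_eq0 subr_eq0 => /eqP.
have [h|h] : j 0 k = i 0 k + 1 \/ j 0 k = i 0 k - 1 by lia.
- left; apply/rowP => l; rewrite !mxE eqxx /=; case: eqP => [->//|/eqP /other ->].
  by rewrite addr0.
- right; apply/rowP => l; rewrite !mxE eqxx /=; case: eqP => [->//|/eqP /other ->].
  by rewrite subr0.
Qed.

Lemma nb_card i : (#|` nb i| <= 2 * d)%N.
Proof.
pose l := [seq i + delta_mx 0 k | k <- enum 'I_d] ++
          [seq i - delta_mx 0 k | k <- enum 'I_d].
have : (size (nb i) <= size l)%N.
  apply: uniq_leq_size; first exact: fset_uniq.
  by move=> j; rewrite in_nb mem_cat => /nnE[k [->|->]]; apply/orP; [left|right];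
    apply/mapP; exists k; rewrite ?mem_enum.
move=> /leq_trans; apply; rewrite size_cat !size_map.
by rewrite -!enumT !size_enum_ord mul2n addnn.
Qed.

Definition l1norm i : nat := (\sum_(k < d) absz (i 0%R k))%N.

Lemma l1normE i : (l1norm i)%:Z = \sum_(k < d) `|i 0 k|.
Proof.
rewrite /l1norm (big_morph Posz PoszD (erefl _)).
by apply: eq_bigr => k _; rewrite abszE.
Qed.

Lemma l1norm_nb i j : j \in nb i -> (l1norm i <= l1norm j + 1)%N.
Proof.
rewrite in_nb => /eqP ij.
suff : (l1norm i)%:Z <= (l1norm j)%:Z + 1 by rewrite -PoszD lez_nat.
rewrite !l1normE -ij -big_split /=; apply: ler_sum => k _.
by rewrite -{1}(subrK (j 0 k) (i 0 k)) addrC ler_normD.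
Qed.

Lemma finite_ball (r : nat) : finite_set [set i | (l1norm i <= r)%N].
Proof.
pose f (g : {ffun 'I_d -> 'I_(2 * r).+1}) : site d := \row_k ((g k : nat)%:Z - r%:Z).
apply: (@sub_finite_set _ _ (f @` setT)%classic); last exact/finite_image/finite_finset.
move=> i /= ir; exists [ffun k => inord (absz (i 0 k + r%:Z))] => //.
apply/rowP => k; rewrite mxE ffunE.
have kr : (absz (i 0%R k) <= r)%N.
  by apply: leq_trans ir; rewrite /l1norm (bigD1 k)//= leq_addr.
rewrite inordK; lia.
Qed.

Definition ball (r : nat) : {fset site d} := fset_set [set i | (l1norm i <= r)%N].

Lemma in_ball r i : (i \in ball r) = (l1norm i <= r)%N.
Proof.
rewrite in_fset_set; last exact: finite_ball.
by apply/idP/idP => [/set_mem|h]; last exact: mem_set.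
Qed.

Section summability.
Variables (R : realType) (theta : R).
Hypotheses (theta0 : 0 <= theta) (theta1 : theta < 1).

(** The induction hypothesis is strengthened by the term 2 theta^(N+1), which
    absorbs the two extreme terms added at each step. *)
Lemma sum_geometric_sym (N : nat) :
  \sum_(0 <= x < (2 * N).+1) theta ^+ absz (x%:Z - N%:Z) <= 2 / (1 - theta).
Proof.
have h1 : 0 < 1 - theta by rewrite subr_gt0.
rewrite ler_pdivlMr//.
suff : (\sum_(0 <= x < (2 * N).+1) theta ^+ absz (x%:Z - N%:Z)) * (1 - theta) <=
    2 - 2 * theta ^+ N.+1.
  by move/le_trans; apply; rewrite gerBl mulr_ge0// exprn_ge0.
elim: N => [|N IH]; first by rewrite muln0 big_nat1 subrr /= expr0; lra.
have -> : (2 * N.+1).+1 = (2 * N).+3 by lia.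
rewrite big_nat_recl// big_nat_recr//.
have -> : absz (0%N%:Z - N.+1%:Z) = N.+1 by lia.
have -> : absz ((2 * N).+2%:Z - N.+1%:Z) = N.+1 by lia.
under eq_bigr => x _.
  rewrite (_ : absz (x.+1%:Z - N.+1%:Z) = absz (x%:Z - N%:Z)); last by lia.
  over.
rewrite [theta ^+ N.+2]exprS.
set t := theta ^+ N.+1 in IH *; set S := \sum_(0 <= x < _) _ in IH *.
rewrite -[X in t + X]/(S + t); nra.
Qed.

(** The sum over a box factorises over the coordinates. The bound does not
    depend on C, which makes the total influence of all clauses outside a large
    ball small, however many they are. *)
Lemma sum_exp_l1norm C : \sum_(i <- C) theta ^+ l1norm i <= (2 / (1 - theta)) ^+ d.
Proof.
pose N := (\sum_(i <- C) l1norm i)%N.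
have CN i k : i \in C -> (absz (i 0%R k) <= N)%N.
  move=> iC; rewrite /N (big_fsetD1 i)//=; apply: leq_trans (leq_addr _ _).
  by rewrite /l1norm (bigD1 k)//= leq_addr.
pose f (u : {ffun 'I_d -> 'I_(2 * N).+1}) : site d := \row_k ((u k : nat)%:Z - N%:Z).
pose h i : {ffun 'I_d -> 'I_(2 * N).+1} := [ffun k => inord (absz (i 0 k + N%:Z))].
have fh i : i \in C -> f (h i) = i.
  move=> iC; apply/rowP => k; rewrite mxE ffunE.
  by have := CN i k iC; move=> kN; rewrite inordK; lia.
have -> : \sum_(i <- C) theta ^+ l1norm i = \sum_(u <- [seq h i | i <- C]) theta ^+ l1norm (f u).
  by rewrite big_map; apply: eq_big_seq => i /fh ->.
rewrite big_uniq; last first.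
  rewrite map_inj_in_uniq ?fset_uniq// => i j /fh iE /fh jE hij.
  by rewrite -iE hij jE.
apply: (@le_trans _ _ (\sum_u theta ^+ l1norm (f u))).
  rewrite [leRHS](bigID (mem [seq h i | i <- C]))/= lerDl sumr_ge0// => u _.
  exact: exprn_ge0.
rewrite (eq_bigr (fun u : {ffun 'I_d -> 'I_(2 * N).+1} =>
    \prod_k theta ^+ absz ((u k : nat)%:Z - N%:Z))); last first.
  by move=> u _; rewrite /l1norm -prodrXr; apply: eq_bigr => k _; rewrite mxE.
rewrite -(bigA_distr_bigA (fun _ (x : 'I_(2 * N).+1) => theta ^+ absz ((x : nat)%:Z - N%:Z)))/=.
rewrite prodr_const card_ord; apply: lerXn2r; rewrite ?nnegrE.
- by rewrite sumr_ge0// => x _; exact: exprn_ge0.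
- by rewrite divr_ge0// subr_ge0 ltW.
- by have := sum_geometric_sym N; rewrite big_mkord.
Qed.

End summability.

(** The left-hand side counts the clauses produced by one step of the
    recursion, at most 2 d a of them, with the weight of an isolated one having
    a neighbours; the bracket is the weight it is compared with. So kappa is a
    contraction factor, uniform in the number a of available neighbours. *)
Definition subcritical (R : realType) (p : R) : Prop :=
  exists2 kappa : R, 0 <= kappa < 1 & forall a : nat, (a <= 2 * d)%N ->
    (2 * d * a)%:R * (p * (1 - p) ^+ a) <=
    kappa * (p + (1 - p) ^+ a.+1 - p * (1 - p) ^+ a).

(** Far away sites and clauses are forgotten at an exponential rate, uniformly
    in the geometry of the system. *)
Lemma avg_mixing (R : realType) (p : R) (s : nat) : 0 <= p -> p < 1 ->
  subcritical p ->
  exists2 e : nat -> R, (e n @[n --> \oo] --> (0 : R))%classic &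
  forall (S : {fset site d}) (g : {fset site d} -> R),
  (forall X, 0 <= g X <= 1) -> depends_on S g ->
  {in S, forall x, (l1norm x <= s)%N} ->
  forall (r : nat) V C, C `<=` V -> (s <= r)%N ->
  `|avg nb p V C g -
    avg nb p [fset x in V | (l1norm x <= r)%N] [fset x in C | (l1norm x < r)%N] g|
  <= e r.
Proof.
move=> p0 p1 [kappa /andP[k0 k1] kP].
(* One factor kappa covers distance two; theta^4 >= kappa leaves theta^2 per
   unit of distance, one theta for the decay and one for the summation. *)
pose theta : R := 1 - (1 - kappa) / 4.
have t0 : 0 < theta by rewrite /theta; lra.
have t1 : theta < 1 by rewrite /theta; lra.
have kt : kappa <= theta ^+ 4.
  have -> : kappa = 1 - 4 * (1 - theta) by rewrite /theta; field.
  have h1 : 0 <= 1 - 2 * (1 - theta) by rewrite /theta; lra.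
  have h2 : 1 - 2 * (1 - theta) <= theta ^+ 2 by nra.
  have : (1 - 2 * (1 - theta)) ^+ 2 <= (theta ^+ 2) ^+ 2.
    by apply: lerXn2r; rewrite ?nnegrE//; rewrite exprn_ge0// ltW.
  by rewrite -exprM; nra.
pose K := (2 / (1 - theta)) ^+ d / theta ^+ (2 * s + 6).
exists (fun r => K * theta ^+ r).
  by apply: cvg_geometric; rewrite ger0_norm ?ltW.
move=> S g g01 gS Ss r V C CV sr.
apply: le_trans (avg_truncate nb_sym nb_irr p0 p1 nb_card l1norm_nb k0 kP g01 gS Ss CV sr) _.
rewrite /K mulrAC ler_pdivlMr ?exprn_gt0// mulrC mulr_sumr.
apply: (@le_trans _ _ (\sum_(x <- [fset x in C | (r <= l1norm x)%N])
  theta ^+ r * theta ^+ l1norm x)).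
  rewrite !big_seq; apply: ler_sum => x; rewrite !inE /= => /andP[_ rx].
  set k := _./2; apply: (@le_trans _ _ (theta ^+ (2 * s + 6) * (theta ^+ 4) ^+ k)).
    rewrite ler_wpM2l ?exprn_ge0 ?(ltW t0)//; apply: lerXn2r; rewrite ?nnegrE//.
    by rewrite exprn_ge0// ltW.
  rewrite -exprM -!exprD ler_wiXn2l ?(ltW t0) ?(ltW t1)//.
  by rewrite /k; move: (l1norm x) rx => n; lia.
rewrite -mulr_sumr mulrC ler_wpM2r ?exprn_ge0 ?(ltW t0)//.
by apply: sum_exp_l1norm => //; exact: ltW.
Qed.

End lattice.

(** * Weights of cylinders under the thinned measure *)

Section cylinder_weights.
Variables (R : realType) (d : nat).
Implicit Types (i j : site d) (L X Y V S M : {fset site d}) (s t : site d -> bool).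

Definition hardcore s : Prop := forall i j, s i -> nn i j -> s j = false.

Definition patch L Y s : site d -> bool :=
  fun i => if i \in L then i \in Y else s i.

(** The thinning map on a configuration given by its finite set of ones. *)
Definition thin_fset X i : bool := (i \in X) && [disjoint nb i & X]%fset.

Definition agree n s X : bool := all (fun i => thin_fset X i == s i) (ball d n).

Lemma agreeP n s X :
  reflect (forall i, (l1norm i <= n)%N -> thin_fset X i = s i) (agree n s X).
Proof.
apply: (iffP allP) => h i; first by rewrite -in_ball => /h /eqP.
by rewrite in_ball => /h /eqP.
Qed.

Variable p : R.

(** The probability that the thinned configuration coincides with s on the
    ball of radius n; it depends on the sites of the ball of radius n + 1. *)
Definition cyl_weight n s : R := bern p (ball d n.+1) (fun X => (agree n s X)%:R).

Lemma eq_cyl_weight n s t : (forall i, (l1norm i <= n)%N -> s i = t i) ->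
  cyl_weight n s = cyl_weight n t.
Proof.
move=> st; apply: eq_bern => X _; congr (nat_of_bool _)%:R.
by apply/agreeP/agreeP => h i ni; rewrite h ?st.
Qed.

Definition nbs Y := \bigcup_(i <- Y) nb i.

Lemma in_nbs Y j : reflect (exists2 i, i \in Y & nn i j) (j \in nbs Y).
Proof.
apply: (iffP (bigfcupP _ _ _ _)) => [[i]|[i iY ij]].
  by rewrite andbT in_nb => iY ij; exists i.
by exists i; rewrite ?iY ?in_nb.
Qed.

Definition clear M X : R := [disjoint X & M]%:R.

Lemma agree_flip n s Y X : hardcore s -> {in Y, forall i, s i} ->
  {in Y, forall i, (l1norm i <= n)%N} -> [disjoint X & Y] ->
  agree n s (Y `|` X) =
  agree n (fun i => s i && (i \notin Y)) X && [disjoint X & nbs Y]%fset.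
Proof.
move=> hs Y1 Yn /fdisjointP XY.
have sN j : j \in nbs Y -> s j = false.
  by case/in_nbs => i /Y1 si /(hs _ _ si).
have thinE j : j \notin Y -> j \notin nbs Y -> thin_fset (Y `|` X) j = thin_fset X j.
  move=> jY jN; rewrite /thin_fset inE (negbTE jY) /=; congr (_ && _).
  rewrite fdisjointXU (_ : [disjoint nb j & Y]%fset)//.
  apply/fdisjointP => i; rewrite in_nb nn_sym => ij; apply/negP => iY.
  by move/negP : jN; apply; apply/in_nbs; exists i.
apply/idP/andP => [/agreeP h|[/agreeP h /fdisjointP XN]].
  have XN : [disjoint X & nbs Y].
    apply/fdisjointP => j jX; apply/negP => /in_nbs[i iY ij].
    have := h i (Yn i iY); rewrite (Y1 i iY) => /andP[_ /fdisjointP/(_ j)].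
    by rewrite in_nb ij inE jX orbT => /(_ isT).
  split=> //; apply/agreeP => j nj.
  have [jY|jY] := boolP (j \in Y).
    rewrite andbF /thin_fset; case: (boolP (j \in X)) => // /XY.
    by rewrite jY.
  rewrite andbT -(h j nj); have [jN|jN] := boolP (j \in nbs Y); last by rewrite thinE.
  rewrite h// sN// /thin_fset; case: (boolP (j \in X)) => // jX.
  by move/fdisjointP : XN => /(_ j jX); rewrite jN.
apply/agreeP => j nj.
have [jY|jY] := boolP (j \in Y).
  rewrite (Y1 j jY) /thin_fset inE jY /=; apply/fdisjointP => i.
  rewrite in_nb inE => ji; apply/negP => /orP[iY|iX].
    by have := hs _ _ (Y1 j jY) ji; rewrite (Y1 i iY).
  by move/negP : (XN i iX); apply; apply/in_nbs; exists j.
have [jN|jN] := boolP (j \in nbs Y); last by rewrite thinE// h// jY andbT.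
rewrite sN//; apply/negbTE/negP => /andP[_ /fdisjointP h1].
case/in_nbs: jN => i iY ij; move: (h1 i); rewrite in_nb nn_sym ij inE iY.
by move=> /(_ isT).
Qed.

(** A one of the thinned configuration is surrounded by zeros. Changing it to
    zero is therefore a bijection onto the configurations that thin to the
    modified pattern and vanish on and around Y. *)
Lemma cyl_weight_flip n s Y : hardcore s -> {in Y, forall i, s i} ->
  {in Y, forall i, (l1norm i <= n)%N} ->
  (1 - p) ^+ #|` Y| * cyl_weight n s = p ^+ #|` Y| *
  bern p (ball d n.+1) (fun X =>
    (agree n (fun i => s i && (i \notin Y)) X)%:R * clear (Y `|` nbs Y) X).
Proof.
move=> hs Y1 Yn.
have YV : Y `<=` ball d n.+1.
  by apply/fsubsetP => i /Yn ni; rewrite in_ball ltnW.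
have -> : cyl_weight n s = p ^+ #|` Y| * bern p (ball d n.+1 `\` Y) (fun X =>
    (agree n s (Y `|` X))%:R).
  rewrite -(bern_one p (fun X => (agree n s X)%:R) YV); apply: eq_bern => X XV.
  have [/agreeP h|_] := boolP (agree n s X); last by rewrite mulr0.
  suff -> : Y `<=` X by rewrite mulr1.
  apply/fsubsetP => i iY; have := h i (Yn i iY); rewrite (Y1 i iY).
  by case/andP.
rewrite mulrCA; congr (_ * _); rewrite -(bern_zero _ _ YV).
apply: eq_bern => X XV; rewrite /clear fdisjointXU.
have [XY|XY] := boolP [disjoint X & Y]%fset; last by rewrite /= mul0r mulr0.
by rewrite mul1r agree_flip// -mulnb natrM.
Qed.

Definition ones n s := [fset x in ball d n | s x].
Definition halo n s := [fset x in ball d n.+1 | (x \notin ones n s) &&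
  ~~ [disjoint nb x & ones n s]%fset].
Definition free n s := (ball d n.+1 `\` ones n s) `\` halo n s.
Definition checked n s := (ball d n `\` ones n s) `\` halo n s.

Lemma in_ones n s x : (x \in ones n s) = (l1norm x <= n)%N && s x.
Proof. by rewrite !inE /= in_ball. Qed.

Lemma in_halo n s x : (x \in halo n s) = [&& (l1norm x <= n.+1)%N, x \notin ones n s &
  ~~ [disjoint nb x & ones n s]%fset].
Proof. by rewrite -in_ball !inE. Qed.

Lemma in_free n s x : (x \in free n s) =
  [&& x \notin halo n s, x \notin ones n s & (l1norm x <= n.+1)%N].
Proof. by rewrite 2!in_fsetD in_ball. Qed.

Lemma in_checked n s x : (x \in checked n s) =
  [&& x \notin halo n s, x \notin ones n s & (l1norm x <= n)%N].
Proof. by rewrite 2!in_fsetD in_ball. Qed.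

(** Thinning to s prescribes the ones of s and the zeros around them; at the
    remaining sites it only forbids isolated ones. *)
Lemma agree_ones n s X : hardcore s -> X `<=` ball d n.+1 `\` ones n s ->
  agree n s (ones n s `|` X) = [disjoint X & halo n s]%fset && sat (@nb d) (checked n s) X.
Proof.
move=> hs; rewrite fsubsetD => /andP[XV /fdisjointP XS].
apply/agreeP/andP => [h|[/fdisjointP XD /satP h] i ni].
  have XD : [disjoint X & halo n s].
    apply/fdisjointP => x xX; apply/negP; rewrite in_halo => /and3P[_ _].
    move/negP; apply; apply/fdisjointP => i; rewrite in_nb => ix; apply/negP => iS.
    have := iS; rewrite in_ones => /andP[ni si].
    have := h i ni; rewrite si => /andP[_ /fdisjointP/(_ x)].
    by rewrite in_nb nn_sym ix inE xX orbT => /(_ isT).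
  split=> //; apply/satP => k; rewrite in_checked => /and3P[kD kS nk] kX.
  have := h k nk; rewrite (_ : s k = false); last first.
    by move: kS; rewrite in_ones nk /=; case: (s k).
  rewrite /thin_fset inE kX orbT /= => /fdisjointP nd.
  apply: contrapT => ne; apply: nd => j jk; rewrite inE negb_or; apply/andP; split; last first.
    by apply/negP => jX; apply: ne; exists j.
  apply/negP => jS; move/negP : kD; apply; rewrite in_halo (leq_trans nk)//.
  by rewrite kS /=; apply/negP => /fdisjointP/(_ j jk); rewrite jS.
have [iS|iS] := boolP (i \in ones n s).
  have := iS; rewrite in_ones => /andP[_ si]; rewrite si /thin_fset inE iS /=.
  apply/fdisjointP => x; rewrite in_nb inE => ix; apply/negP => /orP[|xX].
    by rewrite in_ones => /andP[_ sx]; rewrite (hs _ _ si ix) in sx.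
  move/negP : (XD x xX); apply; rewrite in_halo -in_ball (fsubsetP XV _ xX) XS//=.
  by apply/negP => /fdisjointP/(_ i); rewrite in_nb nn_sym ix iS => /(_ isT).
have -> : s i = false by move: iS; rewrite in_ones ni /=; case: (s i).
rewrite /thin_fset inE (negbTE iS) /=; apply/negbTE/negP => /andP[iX /fdisjointP di].
have [||j ji jX] := h i; rewrite ?iX//.
  by rewrite in_checked ni iS XD.
by move/negP : (di j ji); apply; rewrite inE jX orbT.
Qed.

Lemma bern_agree n s f : hardcore s ->
  bern p (ball d n.+1) (fun X => (agree n s X)%:R * f X) =
  p ^+ #|` ones n s| * ((1 - p) ^+ #|` halo n s| *
    wsum (@nb d) p (free n s) (checked n s) (fun X => f (ones n s `|` X))).
Proof.
move=> hs.
transitivity (bern p (ball d n.+1) (fun X => (ones n s `<=` X)%:R *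
    ((agree n s X)%:R * f X))).
  apply: eq_bern => X XV; have [/agreeP h|_] := boolP (agree n s X); last first.
    by rewrite !mul0r mulr0.
  rewrite (_ : ones n s `<=` X) ?mul1r//; apply/fsubsetP => i.
  by rewrite in_ones => /andP[/h <-] /andP[].
rewrite bern_one; last first.
  by apply/fsubsetP => i; rewrite in_ones in_ball => /andP[/leqW].
congr (_ * _); rewrite -bern_zero; last first.
  apply/fsubsetP => x; rewrite in_halo inE in_ball => /and3P[-> -> _].
  by [].
apply: eq_bern => X XV; rewrite agree_ones// -mulnb natrM mulrA.
by [].
Qed.

Section open_interval.
Hypotheses (p0 : 0 < p) (p1 : p < 1).

Lemma cyl_weight_gt0 n s : hardcore s -> 0 < cyl_weight n s.
Proof.
move=> hs.
have -> : cyl_weight n s = bern p (ball d n.+1) (fun X => (agree n s X)%:R * 1).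
  by apply: eq_bern => X _; rewrite mulr1.
rewrite bern_agree// !mulr_gt0 ?exprn_gt0 ?subr_gt0//.
by apply: total_gt0 => //; exact: ltW.
Qed.

(** The flip multiplies the weight by the odds of a one at each site of Y, times
    a local average in the system without isolated ones. All dependence on the
    distant part of the configuration sits in this average. *)
Lemma cyl_weight_ratio n s Y : hardcore s -> {in Y, forall i, s i} ->
  {in Y, forall i, (l1norm i <= n)%N} ->
  let t := fun i => s i && (i \notin Y) in
  cyl_weight n s / cyl_weight n t = (p / (1 - p)) ^+ #|` Y| *
    avg (@nb d) p (free n t) (checked n t) (clear (Y `|` nbs Y)).
Proof.
move=> hs Y1 Yn t.
have ht : hardcore t.
  by move=> i j /andP[si _] /(hs _ _ si); rewrite /t => ->.
have q0 : 0 < 1 - p by rewrite subr_gt0.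
have t0 := cyl_weight_gt0 n ht.
have z0 : 0 < total (@nb d) p (free n t) (checked n t) by apply: total_gt0 => //; exact: ltW.
have -> : cyl_weight n s = (p / (1 - p)) ^+ #|` Y| *
    bern p (ball d n.+1) (fun X => (agree n t X)%:R * clear (Y `|` nbs Y) X).
  rewrite expr_div_n mulrAC -cyl_weight_flip// mulrAC divff ?mul1r//.
  by rewrite expf_neq0// gt_eqF.
rewrite -mulrA; congr (_ * _).
have -> : cyl_weight n t = p ^+ #|` ones n t| * ((1 - p) ^+ #|` halo n t| *
    total (@nb d) p (free n t) (checked n t)).
  rewrite /total -(bern_agree n (fun=> 1) ht); apply: eq_bern => X _.
  by rewrite mulr1.
rewrite bern_agree//.
have -> : wsum (@nb d) p (free n t) (checked n t)
    (fun X => clear (Y `|` nbs Y) (ones n t `|` X)) =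
  wsum (@nb d) p (free n t) (checked n t) (clear (Y `|` nbs Y)).
  apply: eq_bern => X _; congr (_ * _); rewrite /clear fdisjointUX.
  rewrite (_ : [disjoint ones n t & _]%fset = true)//.
  apply/fdisjointP => x; rewrite in_ones => /andP[_ /andP[sx xY]].
  rewrite inE (negbTE xY) /=; apply/negP => /in_nbs[i iY ix].
  by rewrite (hs _ _ (Y1 i iY) ix) in sx.
by rewrite !mulrA -mulf_div divff ?mul1r// mulf_neq0// expf_neq0// gt_eqF.
Qed.

End open_interval.

End cylinder_weights.

(** * Convergence of the conditional weights *)

Section real_limits.
Variable R : realType.

(** Both normalising sums are at least one, so the division does not amplify
    errors. *)
Lemma normalized_dist (I : eqType) (P : seq I) (u v : I -> R) (delta : R) (y : I) :
  (forall i, 0 <= u i) -> (forall i, 0 <= v i) ->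
  1 <= \sum_(i <- P) u i -> 1 <= \sum_(i <- P) v i ->
  {in P, forall i, `|u i - v i| <= delta} -> y \in P -> uniq P ->
  `|u y / \sum_(i <- P) u i - v y / \sum_(i <- P) v i| <= (1 + (size P)%:R) * delta.
Proof.
move=> u0 v0; set A := \sum_(i <- P) u i; set B := \sum_(i <- P) v i => A1 B1 uv yP uP.
have A0 : 0 < A by apply: lt_le_trans A1; exact: ltr01.
have B0 : 0 < B by apply: lt_le_trans B1; exact: ltr01.
have vB : v y <= B by rewrite /B (big_rem y)//= lerDl sumr_ge0.
have AB : `|B - A| <= (size P)%:R * delta.
  rewrite distrC /A /B -sumrB; apply: le_trans (ler_norm_sum _ _ _) _.
  rewrite (_ : _ * _ = \sum_(i <- P) delta); last first.
    by rewrite big_const_seq count_predT iter_addr_0 mulr_natl.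
  by rewrite !big_seq; apply: ler_sum => i; exact: uv.
have -> : u y / A - v y / B = (u y - v y) / A + v y / B * ((B - A) / A).
  by field; rewrite !gt_eqF.
apply: le_trans (ler_normD _ _) _; rewrite [leRHS]mulrDl mul1r; apply: lerD.
  rewrite normrM normfV (ger0_norm (ltW A0)) ler_pdivrMr//.
  apply: le_trans (uv y yP) _; rewrite ler_peMr//.
  by apply: le_trans (uv y yP); exact: normr_ge0.
rewrite normrM; apply: le_trans AB; rewrite -[leRHS]mul1r ler_pM//.
  by rewrite ger0_norm ?divr_ge0 ?(ltW B0)// ler_pdivrMr// mul1r.
by rewrite normrM normfV (ger0_norm (ltW A0)) ler_pdivrMr// ler_peMr.
Qed.

Lemma cvg_of_rate (u e : nat -> R) (n0 : nat) :
  (e n @[n --> \oo] --> (0 : R))%classic ->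
  (forall n m, (n0 <= n)%N -> (n < m)%N -> `|u n.+1 - u m| <= e n) ->
  (u n @[n --> \oo] --> lim (u n @[n --> \oo]))%classic /\
  forall n, (n0 <= n)%N -> `|u n.+1 - lim (u n @[n --> \oo])%classic| <= e n.
Proof.
move=> e0 ue.
have uc : cvg (u n @[n --> \oo])%classic.
  apply: cauchy_cvg; apply: cauchy_exP => eps eps0.
  have /cvgrPdist_lt/(_ _ eps0) [N _ hN] := e0.
  exists (u (maxn n0 N).+1); exists (maxn n0 N).+1 => // m /= nm.
  apply: le_lt_trans (ue _ _ (leq_maxl n0 N) nm) _.
  have := hN _ (leq_maxr n0 N); rewrite sub0r normrN; apply: le_lt_trans.
  exact: ler_norm.
split=> // n n0n.
have h : (`|u n.+1 - u m| @[m --> \oo] --> `|u n.+1 - lim (u n @[n --> \oo])|)%classic.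
  by apply: cvg_norm; apply: cvgB => //; exact: cvg_cst.
rewrite -(cvg_lim _ h)//; apply: limr_le; first exact: cvgP h.
exists n.+1 => // m /= nm; exact: ue.
Qed.

End real_limits.

Lemma in_sep (K : choiceType) (A : {fset K}) (P : pred K) x :
  (x \in [fset y in A | P y]) = (x \in A) && P x.
Proof. by rewrite !inE. Qed.

Section conditional_weights.
Variables (R : realType) (d : nat) (p : R).
Hypotheses (p0 : 0 < p) (p1 : p < 1).
Implicit Types (i j : site d) (L X Y V S M : {fset site d}) (s t : site d -> bool).

Let q0 : 0 < 1 - p. Proof. by rewrite subr_gt0. Qed.

Definition cyl_total n L s : R := \sum_(Y <- fpowerset L) cyl_weight p n (patch L Y s).
(** The conditional probability, given the thinned configuration s on a ball
    minus L, that its ones inside L are those of Y. *)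
Definition cond_weight n L Y s : R := cyl_weight p n (patch L Y s) / cyl_total n L s.

Lemma cyl_weight_ge0 n s : 0 <= cyl_weight p n s.
Proof. by apply: bern_ge0; rewrite ?ltW. Qed.

Lemma cyl_weight_not_hardcore n s i j : (l1norm i <= n)%N -> (l1norm j <= n)%N ->
  s i -> s j -> nn i j -> cyl_weight p n s = 0.
Proof.
move=> ni nj si sj ij; rewrite -(bern_cst p (ball d n.+1) 0); apply: eq_bern => X _.
have [/agreeP h|//] := boolP (agree n s X).
have := h i ni; rewrite si => /andP[_ /fdisjointP/(_ j)].
by have := h j nj; rewrite in_nb ij sj => /andP[-> _] /(_ isT).
Qed.

Lemma hardcore_patch0 L s : hardcore s -> hardcore (patch L fset0 s).
Proof.
move=> hs i j; rewrite /patch; case: ifP => // _ si ij.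
by case: ifP => // _; exact: hs si ij.
Qed.

Lemma fset_l1norm_bound L : exists N, {in L, forall i, (l1norm i <= N)%N}.
Proof.
exists (\sum_(i <- L) l1norm i)%N => i iL.
by rewrite (big_fsetD1 i)//= leq_addr.
Qed.

Lemma patch_not_hardcore L Y s N : hardcore s -> {in L, forall i, (l1norm i <= N)%N} ->
  ~ hardcore (patch L Y s) -> forall n, (N < n)%N -> cyl_weight p n (patch L Y s) = 0.
Proof.
move=> hs LN /existsNP[i] /existsNP[j] /not_implyP[si] /not_implyP[ij /eqP].
rewrite eqbF_neg negbK => sj n Nn.
have [iL|iL] := boolP (i \in L).
  have ji : (l1norm j <= l1norm i + 1)%N by apply: l1norm_nb; rewrite in_nb nn_sym.
  apply: (cyl_weight_not_hardcore _ _ si sj ij).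
    exact: leq_trans (LN i iL) (ltnW Nn).
  by apply: leq_trans ji _; rewrite addn1; apply: leq_ltn_trans (LN i iL) Nn.
have [jL|jL] := boolP (j \in L).
  have ji : (l1norm i <= l1norm j + 1)%N by apply: l1norm_nb; rewrite in_nb.
  apply: (cyl_weight_not_hardcore _ _ si sj ij).
    by apply: leq_trans ji _; rewrite addn1; apply: leq_ltn_trans (LN j jL) Nn.
  exact: leq_trans (LN j jL) (ltnW Nn).
move: si sj; rewrite /patch (negbTE iL) (negbTE jL) => si.
by rewrite (hs _ _ si ij).
Qed.

Lemma patch0E L Y s : Y `<=` L -> 
  (fun i => patch L Y s i && (i \notin Y)) = patch L fset0 s.
Proof.
move=> YL; apply/funext => i; rewrite /patch; case: ifPn => [_|iL].
  by rewrite andbN inE.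
by rewrite (contra (fsubsetP YL i) iL) andbT.
Qed.

Lemma free_local n r t x : (l1norm x <= r)%N -> (r < n)%N ->
  (x \in free n t) = ~~ t x && ~~ has t (nb x).
Proof.
move=> xr rn; rewrite in_free (leq_trans xr)//; last by rewrite ltnW// ltnW.
have xn : (l1norm x <= n)%N by apply: leq_trans xr (ltnW rn).
rewrite andbT andbC in_ones xn /=; case: (boolP (t x)) => //= tx.
rewrite in_halo (leq_trans xn)//= in_ones (negbTE tx) andbF /= negbK.
apply/fdisjointP/hasPn => h i ix.
  have := h i ix; rewrite in_ones negb_and => /orP[|//].
  have : (l1norm i <= l1norm x + 1)%N by apply: l1norm_nb; rewrite nb_sym.
  by move=> h1 /negP[]; apply: leq_trans h1 _; rewrite addn1 (leq_ltn_trans xr).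
by rewrite in_ones negb_and h ?orbT.
Qed.

Lemma checked_free n s : checked n s = [fset x in free n s | (l1norm x <= n)%N].
Proof.
apply/fsetP => x; rewrite in_checked !inE /= in_ball.
case: (boolP (l1norm x <= n)%N) => xn; rewrite ?andbF ?(leqW xn) ?andbT//.
Qed.

Lemma clear_depends M : depends_on M (clear R M).
Proof.
move=> X; rewrite /clear; congr (nat_of_bool _)%:R.
apply/fdisjointP/fdisjointP => h x; first by rewrite inE => /andP[/h].
move=> xX; apply/negP => xM; have := h x.
by rewrite inE xX xM => /(_ isT).
Qed.

(** Seen from a ball of radius n, the two systems of free sites are the same, so
    both averages are close to the same truncated average. *)
Lemma cyl_weight_ratio_cauchy L : subcritical d p ->
  exists2 e : nat -> R, (e n @[n --> \oo] --> (0 : R))%classic &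
  exists n0, forall s Y, hardcore s -> Y `<=` L ->
  forall n m, (n0 <= n)%N -> (n < m)%N ->
  `|cyl_weight p n.+1 (patch L Y s) / cyl_weight p n.+1 (patch L fset0 s) -
    cyl_weight p m (patch L Y s) / cyl_weight p m (patch L fset0 s)| <= e n.
Proof.
move=> sub; have [N LN] := fset_l1norm_bound L.
have [e e0 mix] := avg_mixing (N + 1) (ltW p0) p1 sub.
pose K := (1 + p / (1 - p)) ^+ #|` L|.
have pq0 : 0 <= p / (1 - p) by rewrite divr_ge0 ?ltW.
have K0 : 0 <= K by rewrite exprn_ge0// addr_ge0.
exists (fun n => K * (e n + e n)).
  rewrite -[X in (_ --> X)%classic](mulr0 K) -[X in K * X](addr0 0).
  by apply: cvgMr; apply: cvgD.
exists (N + 1)%N => s Y hs YL n m Nn nm.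
have h0 : hardcore (patch L fset0 s) := hardcore_patch0 hs.
have enn : 0 <= e n.
  have := mix fset0 (fun=> 0) _ _ _ n fset0 fset0 _ Nn.
  by move=> /(_ _ _ _ _)/(le_trans (normr_ge0 _)); apply => // X; rewrite lexx ler01.
(* both ratios vanish if the pattern has adjacent ones *)
have [hY|hY] := pselect (hardcore (patch L Y s)); last first.
  rewrite !(patch_not_hardcore hs LN hY) ?mul0r ?subrr ?normr0 ?mulr_ge0 ?addr_ge0//.
    by apply: leq_trans nm; rewrite ltnS (leq_trans _ Nn)// leq_addr.
  by rewrite ltnS (leq_trans _ Nn)// leq_addr.
have Y1 : {in Y, forall i, patch L Y s i}.
  by move=> i iY; rewrite /patch (fsubsetP YL _ iY).
have YN : {in Y, forall i, (l1norm i <= N)%N} by move=> i /(fsubsetP YL)/LN.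
have Nn' : (N <= n)%N by apply: leq_trans Nn; exact: leq_addr.
have Yk k : (n < k)%N -> {in Y, forall i, (l1norm i <= k)%N}.
  by move=> nk i /YN iN; apply: leq_trans iN (leq_trans Nn' (ltnW nk)).
have r1 := cyl_weight_ratio p0 p1 hY Y1 (Yk _ (ltnSn n)).
have r2 := cyl_weight_ratio p0 p1 hY Y1 (Yk _ nm).
rewrite /= patch0E// in r1 r2; rewrite r1 r2.
set t := patch L fset0 s; set M := Y `|` nbs Y.
have M01 X : 0 <= clear R M X <= 1.
  by rewrite /clear; case: [disjoint X & M]%fset; rewrite lexx ler01.
have MN : {in M, forall x, (l1norm x <= N + 1)%N}.
  move=> x; rewrite inE => /orP[/YN xN|/in_nbs[i /YN iN ix]].
    by apply: leq_trans xN (leq_addr _ _).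
  by apply: leq_trans (_ : l1norm i + 1 <= _)%N; rewrite ?leq_add2r// l1norm_nb// in_nb nn_sym.
have sub1 k : checked k t `<=` free k t.
  by rewrite checked_free fset_sub.
have mixn k : (n < k)%N -> `|avg (@nb d) p (free k t) (checked k t) (clear R M) -
    avg (@nb d) p [fset x in ball d n | ~~ t x && ~~ has t (nb x)]
      [fset x in ball d n | (l1norm x < n)%N && (~~ t x && ~~ has t (nb x))] (clear R M)| <= e n.
  move=> nk; have := mix M _ M01 (clear_depends M) MN n _ _ (sub1 k) Nn.
  congr (`|_ - avg _ _ _ _ _| <= _); apply/fsetP => x; rewrite !in_sep in_ball.
    have [xn|xn] := leqP (l1norm x) n; last by rewrite andbF.
    by rewrite andbT (free_local _ xn nk).
  have [xn|xn] := ltnP (l1norm x) n; last by rewrite !andbF.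
  rewrite andbT checked_free in_sep (free_local _ (ltnW xn) nk) (ltnW xn) /=.
  by rewrite (leq_trans (ltnW xn) (ltnW nk)) andbT.
rewrite -mulrBr normrM ger0_norm ?exprn_ge0//; apply: ler_pM => //.
- by rewrite exprn_ge0.
- apply: (@le_trans _ _ ((1 + p / (1 - p)) ^+ #|` Y|)).
    by apply: lerXn2r; rewrite ?nnegrE ?addr_ge0// lerDr.
  by apply: ler_weXn2l; rewrite ?lerDl// fsubset_leq_card.
apply: le_trans (ler_distD _ _ _) (lerD (mixn n.+1 (ltnSn n)) _).
by rewrite distrC mixn.
Qed.

Lemma patch_overwrite L D Y Z s : L `<=` D -> Y `<=` D -> Z `<=` L ->
  patch L Z (patch D Y s) = patch D ((Y `\` L) `|` Z) s.
Proof.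
move=> LD YD ZL; apply/funext => i; rewrite /patch !inE.
have [iL|iL] := boolP (i \in L); first by rewrite (fsubsetP LD _ iL).
by rewrite (negbTE (contra (fsubsetP ZL i) iL)) orbF.
Qed.

Lemma cyl_total_gt0 n L s : hardcore s -> 0 < cyl_total n L s.
Proof.
move=> hs; rewrite /cyl_total (big_fsetD1 fset0) ?fpowersetE ?fsub0set//=.
rewrite ltr_wpDr ?cyl_weight_gt0//; last exact: hardcore_patch0.
by rewrite sumr_ge0// => Y _; exact: cyl_weight_ge0.
Qed.

Lemma cond_weight_ge0 n L Y s : 0 <= cond_weight n L Y s.
Proof. by rewrite divr_ge0 ?cyl_weight_ge0// sumr_ge0// => Y' _; exact: cyl_weight_ge0. Qed.

Lemma sum_cond_weight n L s : hardcore s -> \sum_(Y <- fpowerset L) cond_weight n L Y s = 1.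
Proof. by move=> hs; rewrite -mulr_suml divff// gt_eqF// cyl_total_gt0. Qed.

Lemma cond_weight_cauchy L : subcritical d p ->
  exists2 e : nat -> R, (e n @[n --> \oo] --> (0 : R))%classic &
  exists n0, forall s Y, hardcore s -> Y `<=` L ->
  forall n m, (n0 <= n)%N -> (n < m)%N ->
  `|cond_weight n.+1 L Y s - cond_weight m L Y s| <= e n.
Proof.
move=> /(cyl_weight_ratio_cauchy L)[e e0 [n0 he]].
exists (fun n => (1 + (size (fpowerset L))%:R) * e n).
  by rewrite -[X in (_ --> X)%classic](mulr0 (1 + (size (fpowerset L))%:R)); exact: cvgMr.
exists n0 => s Y hs YL n m Nn nm.
pose u k Y := cyl_weight p k (patch L Y s) / cyl_weight p k (patch L fset0 s).
have c0 k : 0 < cyl_weight p k (patch L fset0 s).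
  by apply: cyl_weight_gt0 => //; exact: hardcore_patch0.
have u0 k Y' : 0 <= u k Y' by rewrite divr_ge0 ?cyl_weight_ge0.
have condE k : cond_weight k L Y s = u k Y / \sum_(Y' <- fpowerset L) u k Y'.
  rewrite -mulr_suml /cond_weight -/(cyl_total k L s) /u.
  by field; rewrite !gt_eqF ?cyl_total_gt0.
have u1 k : 1 <= \sum_(Y' <- fpowerset L) u k Y'.
  rewrite (big_fsetD1 fset0) ?fpowersetE ?fsub0set//= {1}/u divff ?gt_eqF//.
  by rewrite lerDl sumr_ge0.
rewrite !condE; apply: normalized_dist; rewrite ?fpowersetE ?fset_uniq//.
by move=> Y'; rewrite fpowersetE => Y'L; exact: he.
Qed.

Section limit.
Hypothesis sub : subcritical d p.

Definition lim_weight L Y s : R := lim (cond_weight n L Y s @[n --> \oo])%classic.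

Lemma cond_weight_rate L :
  exists2 e : nat -> R, (e n @[n --> \oo] --> (0 : R))%classic &
  exists n0, forall s Y, hardcore s -> Y `<=` L -> forall n, (n0 <= n)%N ->
  `|cond_weight n.+1 L Y s - lim_weight L Y s| <= e n.
Proof.
have [e e0 [n0 he]] := cond_weight_cauchy L sub; exists e => //; exists n0 => s Y hs YL.
by have [] := cvg_of_rate e0 (he s Y hs YL).
Qed.

Lemma cond_weight_cvg L Y s : hardcore s -> Y `<=` L ->
  (cond_weight n L Y s @[n --> \oo] --> lim_weight L Y s)%classic.
Proof.
move=> hs YL; have [e e0 [n0 he]] := cond_weight_cauchy L sub.
by have [] := cvg_of_rate e0 (he s Y hs YL).
Qed.

Lemma lim_weight_ge0 L Y s : hardcore s -> Y `<=` L -> 0 <= lim_weight L Y s.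
Proof.
move=> hs YL; apply: limr_ge; first exact: cvgP (cond_weight_cvg hs YL).
by apply: nearW => n; exact: cond_weight_ge0.
Qed.

Lemma sum_lim_weight L s : hardcore s -> \sum_(Y <- fpowerset L) lim_weight L Y s = 1.
Proof.
move=> hs.
have h : (\sum_(Y <- fpowerset L) cond_weight n L Y s @[n --> \oo] -->
    \sum_(Y <- fpowerset L) lim_weight L Y s)%classic.
  rewrite big_seq; under eq_fun do rewrite big_seq.
  by apply: cvg_big => [|Y]; [exact: add_continuous|rewrite fpowersetE; exact: cond_weight_cvg].
rewrite -(cvg_lim _ h)//; under eq_fun do rewrite sum_cond_weight//.
by rewrite lim_cst.
Qed.

Lemma lim_weight_not_hardcore L Y s : hardcore s -> Y `<=` L ->
  ~ hardcore (patch L Y s) -> lim_weight L Y s = 0.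
Proof.
move=> hs YL hY; have [N LN] := fset_l1norm_bound L.
apply/cvg_lim => //; apply: cvg_near_cst; exists N.+1 => // n /= Nn.
by rewrite /cond_weight (patch_not_hardcore hs LN)// mul0r.
Qed.

(** Both sides are, before the limit, the product of the probabilities of the
    same two patterns divided by the same normalisations. *)
Lemma lim_weight_balance L D Y Z s : L `<=` D -> Y `<=` D -> Z `<=` L ->
  let Y' := (Y `\` L) `|` Z in
  hardcore s -> hardcore (patch D Y s) -> hardcore (patch D Y' s) ->
  lim_weight D Y s * lim_weight L Z (patch D Y s) =
  lim_weight D Y' s * lim_weight L (Y `&` L) (patch D Y' s).
Proof.
move=> LD YD ZL Y' hs h1 h2.
have Y'D : Y' `<=` D.
  by rewrite fsubUset (fsubset_trans ZL LD) andbT (fsubset_trans _ YD)// fsubsetDl.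
have := cvgM (cond_weight_cvg hs YD) (cond_weight_cvg h1 ZL).
have := cvgM (cond_weight_cvg hs Y'D) (cond_weight_cvg h2 (fsubsetIr Y L)).
move=> c2 c1; rewrite -(cvg_lim _ (c1 _))// -(cvg_lim _ (c2 _))//.
congr (lim (_ @ \oo)%classic); apply/funext => n /=.
rewrite /cond_weight !patch_overwrite ?fsubsetIr//.
have -> : Y' `\` L `|` Y `&` L = Y.
  apply/fsetP => i; rewrite !inE; have [iL|iL] := boolP (i \in L).
    by rewrite andbT.
  by rewrite (negbTE (contra (fsubsetP ZL i) iL)) /= andbF !orbF.
have -> : cyl_total n L (patch D Y' s) = cyl_total n L (patch D Y s).
  apply: eq_big_seq => X; rewrite fpowersetE => XL; congr cyl_weight.
  rewrite !patch_overwrite//; congr (patch _ _ _); apply/fsetP => i; rewrite !inE.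
  have [iL|iL] := boolP (i \in L) => //=.
  by rewrite (negbTE (contra (fsubsetP ZL i) iL)) orbF.
by rewrite mulrACA [in RHS]mulrACA [_ * cyl_weight _ _ _]mulrC.
Qed.

End limit.

End conditional_weights.

(** * The topology of the thinned configurations *)

Section topology.
Variable d : nat.
Implicit Types (i j : site d) (L X Y : {fset site d}) (w : tconfig d).

Lemma thin_hardcore (s : config d) : hardcore (thin s).
Proof.
by move=> i j /andP[_ /asboolP h] ij; rewrite /thin (h j ij).
Qed.

Lemma spin_hardcore w : hardcore (spin w).
Proof.
rewrite /spin; case: w => s /= sT; case: (set_mem sT) => s' _ <-.
exact: thin_hardcore.
Qed.

Lemma thin_id (s : config d) : hardcore s -> thin s = s.
Proof.
move=> hs; apply/funext => i; rewrite /thin; case si : (s i) => //=.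
by apply/asboolP => j; exact: hs.
Qed.

Lemma spin_thinning (s : config d) : spin (thinning s) = thin s.
Proof. by []. Qed.

Definition repl L Y w : tconfig d := thinning (patch L Y (spin w) : config d).

Lemma spin_repl L Y w : hardcore (patch L Y (spin w)) ->
  spin (repl L Y w) = patch L Y (spin w).
Proof. exact: thin_id. Qed.

Lemma spin_near w i : \forall w' \near w, spin w' i = spin w i.
Proof.
have := @initial_continuous (tconfig d) (config d) set_val w.
by move=> /(_ _ (config_near (set_val w) i)).
Qed.

Lemma spin_near_fset w L : \forall w' \near w, {in L, forall i, spin w' i = spin w i}.
Proof.
have : \forall w' \near w,
    (\bigcap_(i in [set` L]) [set v : tconfig d | spin v i = spin w i]) w'.
  by apply: filter_bigI => i _; exact: spin_near.
by apply: filterS => w' h i iL; exact: h.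
Qed.

Definition near_cyl n w : set (tconfig d) :=
  [set w' | forall i, (l1norm i <= n)%N -> spin w' i = spin w i].

Lemma nbhs_near_cyl n w : nbhs w (near_cyl n w).
Proof.
by apply: filterS (spin_near_fset w (ball d n)) => w' h i ni; rewrite h ?in_ball.
Qed.

(** Otherwise some sequence would agree with w on larger and larger balls while
    staying outside U, although it converges to w in the product topology. *)
Lemma near_cyl_sub (U : set (tconfig d)) w : open U -> U w ->
  exists n, (near_cyl n w `<=` U)%classic.
Proof.
move=> [W oW <-] Ww; apply: contrapT => ne.
have /choice[u hu] n : exists v, near_cyl n w v /\ ~ W (set_val v).
  apply: contrapT => nn; apply: ne; exists n => v nv.
  by apply: contrapT => nW; apply: nn; exists v.
have cu : (fun n => set_val (u n) : config d) @ \oo --> (set_val w : config d).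
  apply/cvg_sup => i A [_ [[B oB <-] Bw] sBA].
  exists (l1norm i) => // n /= ni; apply: sBA.
  have e : (set_val (u n) : config d) i = (set_val w : config d) i := (hu n).1 i ni.
  suff : B ((set_val (u n) : config d) i) by [].
  by rewrite e; exact: Bw.
have : nbhs (set_val w : config d) W by apply: open_nbhs_nbhs.
by move/cu => [N _ /(_ N (leqnn N))]; exact: (hu N).2.
Qed.

Lemma local_continuous (f : tconfig d -> tconfig d) :
  (forall w i, \forall w' \near w, spin (f w') i = spin (f w) i) -> continuous f.
Proof.
move=> fl; apply/continuousP => U oU; rewrite openE => w /= Ufw.
have [n nU] := near_cyl_sub oU Ufw.
have : \forall w' \near w, (\bigcap_(i in [set` ball d n])
    [set v : tconfig d | spin (f v) i = spin (f w) i]) w'.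
  by apply: filter_bigI => i _; exact: fl.
by apply: filterS => w' h; apply: nU => i ni; apply: h; rewrite /= in_ball.
Qed.

Lemma repl_continuous L Y : continuous (repl L Y).
Proof.
apply: local_continuous => w i.
apply: filterS (spin_near_fset w (i |` nb i)) => w' h.
rewrite /repl !spin_thinning /thin /patch; congr (_ && _).
  by case: ifP => // _; rewrite h ?fset1U1.
apply: asbool_equiv_eq; split=> h1 j ij; have := h1 j ij; case: ifP => // _;
  by rewrite h// fset1Ur// in_nb.
Qed.

Lemma continuous_measurable_tconfig (f : tconfig d -> tconfig d) :
  continuous f -> measurable_fun setT f.
Proof.
move=> /continuousP fc; apply: (@measurability _ _ _ _ _ _ (@open (tconfig d))) => //.
by move=> _ [B oB <-]; rewrite setTI; apply: sub_sigma_algebra; exact: fc.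
Qed.

Lemma open_measurable_tconfig (U : set (tconfig d)) : open U -> measurable U.
Proof. by move=> oU; exact: sub_sigma_algebra. Qed.

Lemma continuous_measurable_real (R : realType) (f : tconfig d -> R) :
  continuous f -> measurable_fun setT f.
Proof.
move=> /continuousP fc; apply: (measurability _ (RGenOInfty.measurableE R)).
move=> _ [_ [x ->] <-]; rewrite setTI; apply: open_measurable_tconfig.
by apply: fc; exact: interval_open.
Qed.

Definition finitely_determined n (A : set (tconfig d)) : Prop :=
  forall w w', (forall i, (l1norm i <= n)%N -> spin w i = spin w' i) -> A w -> A w'.

Lemma finitely_determined_open n A : finitely_determined n A -> open A.
Proof.
move=> An; rewrite openE => w Aw.
by apply: filterS (nbhs_near_cyl n w) => w' h; apply: An Aw => i /h.
Qed.

End topology.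

(** Exchanging the part of X inside L with Y is an involution of the pairs. *)
Lemma sum_resample (R : realType) (K : choiceType) (B L : {fset K})
    (F : {fset K} -> {fset K} -> R) : L `<=` B ->
  \sum_(X <- fpowerset B) \sum_(Y <- fpowerset L) F X Y =
  \sum_(X <- fpowerset B) \sum_(Y <- fpowerset L) F ((X `\` L) `|` Y) (X `&` L).
Proof.
move=> LB; pose h (u : {fset K} * {fset K}) := ((u.1 `\` L) `|` u.2, u.1 `&` L).
pose s := [seq (X, Y) | X <- fpowerset B, Y <- fpowerset L].
have pairE G : \sum_(X <- fpowerset B) \sum_(Y <- fpowerset L) G X Y =
    \sum_(u <- s) G u.1 u.2 :> R.
  by rewrite /s big_allpairs.
have ms u : (u \in s) = (u.1 `<=` B) && (u.2 `<=` L).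
  apply/allpairsP/andP => [[[X Y] /= [+ + ->]]|[h1 h2]].
    by rewrite !fpowersetE.
  by exists u; rewrite !fpowersetE; split=> //; case: (u).
have us : uniq s.
  by apply: allpairs_uniq; rewrite ?fset_uniq// => -[X Y] [X' Y'] _ _ [-> ->].
have hs u : u \in s -> h u \in s.
  rewrite !ms /= => /andP[uB uL]; rewrite fsubsetIr andbT fsubUset.
  by rewrite (fsubset_trans uL LB) andbT (fsubset_trans _ uB)// fsubsetDl.
have hK u : u \in s -> h (h u) = u.
  rewrite ms; case: u => X Y /= /andP[XB YL]; rewrite /h /=; congr pair;
    apply/fsetP => i; rewrite !inE; have [iL|iL] := boolP (i \in L);
    rewrite /= ?andbT ?andbF ?orbF //=; by rewrite (negbTE (contra (fsubsetP YL i) iL)) ?orbF.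
rewrite !pairE; transitivity (\sum_(u <- [seq h u | u <- s]) F u.1 u.2).
  apply: perm_big; apply: uniq_perm => //.
    by rewrite map_inj_in_uniq// => u v us' vs' /(congr1 h); rewrite !hK.
  move=> u; apply/idP/mapP => [us'|[v vs ->]]; last exact: hs.
  by exists (h u); rewrite ?hs ?hK.
by rewrite big_map.
Qed.

Local Open Scope classical_set_scope.
Local Open Scope ring_scope.

(** * From weights to Gibbs measures *)

(** Two measures of total mass one, one of them below the other on a set and on
    its complement, agree there. *)
Lemma eq_of_le_total (R : realType) (x y a b : \bar R) :
  (0 <= x -> 0 <= y -> x <= a -> y <= b -> x + y = 1 -> a + b = 1 -> x = a)%E.
Proof.
case: x => [x| |]; case: y => [y| |]; case: a => [a| |]; case: b => [b| |] //=.
by rewrite -!EFinD !lee_fin => _ _ xa yb -[xy] -[ab]; congr (_%:E); lra.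
Qed.

Section weights_to_specification.
Variables (R : realType) (d : nat).
Variable G : {fset site d} -> {fset site d} -> tconfig d -> R.
Implicit Types (L D X Y Z : {fset site d}) (w : tconfig d).
Local Notation "A `<=f` B" := (fsubset A B) (at level 70).

Hypothesis G_ge0 : forall L Y w, Y `<=f` L -> 0 <= G L Y w.
Hypothesis G_sum1 : forall L w, \sum_(Y <- fpowerset L) G L Y w = 1.
Hypothesis G_hardcore : forall L Y w, Y `<=f` L ->
  ~ hardcore (patch L Y (spin w)) -> G L Y w = 0.
Hypothesis G_outside : forall L Y w w', Y `<=f` L ->
  (forall i, i \notin L -> spin w i = spin w' i) -> G L Y w = G L Y w'.
Hypothesis G_continuous : forall L Y, Y `<=f` L -> continuous (G L Y).
Hypothesis G_balance : forall L D Y Z w, L `<=f` D -> Y `<=f` D -> Z `<=f` L ->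
  G D Y w * G L Z (repl D Y w) =
  G D ((Y `\` L) `|` Z)%fset w * G L (Y `&` L)%fset (repl D ((Y `\` L) `|` Z)%fset w).

Let nth_subset L n := nth fset0 (fpowerset L) n.

(** The kernel that redraws the configuration inside L. It is a finite mixture of
    Dirac masses; the absolute value only serves to have a nonnegative weight
    for every L, Y and w. *)
Definition resample L w : set (tconfig d) -> \bar R :=
  msum (fun n => mscale (`|G L (nth_subset L n) w|%:nng) (\d_ (repl L (nth_subset L n) w)))
       (size (fpowerset L)).

HB.instance Definition _ L w := Measure.on (resample L w).

Let resample_meas L w : {measure set (tconfig d) -> \bar R} := resample L w.

Lemma nth_subset_sub L n : (n < size (fpowerset L))%N -> nth_subset L n `<=f` L.
Proof. by move=> nL; rewrite -fpowersetE mem_nth. Qed.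

Lemma resampleE L w A :
  resample L w A = (\sum_(Y <- fpowerset L) G L Y w * \1_A (repl L Y w))%:E.
Proof.
rewrite /resample /msum (big_nth fset0) big_mkord -sumEFin; apply: eq_bigr => n _.
rewrite EFinM -[in RHS](ger0_norm (G_ge0 _ (nth_subset_sub (ltn_ord n)))).
by [].
Qed.

Lemma integral_resample L w (f : tconfig d -> \bar R) :
  (forall w', (0 <= f w')%E) -> measurable_fun setT f ->
  (\int[resample L w]_w' f w' =
   \sum_(Y <- fpowerset L) (G L Y w)%:E * f (repl L Y w))%E.
Proof.
move=> f0 mf; rewrite ge0_integral_measure_sum// (big_nth fset0) big_mkord.
apply: eq_bigr => n _; rewrite ge0_integral_mscale//= integral_dirac//.
rewrite diracT mul1e -[in RHS](ger0_norm (G_ge0 _ (nth_subset_sub (ltn_ord n)))).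
by [].
Qed.

Lemma measurable_resample L A : measurable A ->
  measurable_fun setT (fun w => resample L w A).
Proof.
move=> mA; under eq_fun do rewrite resampleE.
apply/measurable_EFinP; under eq_fun do rewrite big_seq.
apply: (eq_measurable_fun (fun w => \sum_(Y <- fpowerset L)
  (if Y \in fpowerset L then G L Y w * \1_A (repl L Y w) else 0))).
  by move=> w _; rewrite -big_mkcond.
apply: measurable_sum => Y; have [|_] := boolP (Y \in fpowerset L); last exact: measurable_cst.
rewrite fpowersetE => YL.
apply: measurable_funM.
  exact: continuous_measurable_real (G_continuous YL).
have m1 : measurable_fun setT (\1_A : tconfig d -> R) by exact: measurable_indic.
exact: measurableT_comp m1 (continuous_measurable_tconfig (@repl_continuous d L Y)).
Qed.

Lemma resampleT L w : resample L w setT = 1%E.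
Proof.
rewrite resampleE -[RHS](congr1 EFin (G_sum1 L w)); congr (_%:E).
by apply: eq_bigr => Y _; rewrite indicT mulr1.
Qed.

HB.instance Definition _ L :=
  isKernel.Build _ _ _ _ R (resample_meas L) (measurable_resample L).

HB.instance Definition _ L :=
  Kernel_isProbability.Build _ _ _ _ R (resample_meas L) (resampleT L).

Definition resample_kernel L : R.-pker (tconfig d) ~> (tconfig d) :=
  resample_meas L.

(** Consistency comes from reversibility: by the balance relation, redrawing D
    and then L has the same weights as redrawing D, seen from the second
    configuration. *)
Lemma resample_specification : specification resample_kernel.
Proof.
split.
- move=> L A mA _ w w' ww'; rewrite /resample_kernel/= /resample_meas !resampleE.
  congr (_%:E); apply: eq_big_seq => Y; rewrite fpowersetE => YL.
  rewrite (G_outside YL ww') /repl (_ : patch L Y (spin w) = patch L Y (spin w'))//.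
  by apply/funext => i; rewrite /patch; case: ifPn => // /ww'.
- move=> L w; rewrite [LHS]resampleE -[RHS](congr1 EFin (G_sum1 L w)); congr (_%:E).
  apply: eq_big_seq => Y; rewrite fpowersetE => YL.
  have [h|h] := pselect (hardcore (patch L Y (spin w))); last by rewrite G_hardcore// mul0r.
  rewrite indicE mem_set ?mulr1//= => i iL.
  by rewrite spin_repl// /patch (negbTE iL).
- move=> L D LD A mA w; rewrite [LHS]integral_resample//; last exact: measurable_resample.
  rewrite [RHS]resampleE.
  under eq_bigr do rewrite /resample_kernel/= /resample_meas resampleE -EFinM.
  rewrite sumEFin; congr (_%:E).
  pose H X Y := G D X w * G L Y (repl D X w) * \1_A (repl D X w).
  transitivity (\sum_(X <- fpowerset D) \sum_(Y <- fpowerset L) H X Y); last first.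
    by apply: eq_bigr => X _; rewrite -mulr_suml -mulr_sumr G_sum1 mulr1.
  rewrite (sum_resample _ LD); apply: eq_big_seq => Y; rewrite fpowersetE => YD.
  rewrite mulr_sumr; apply: eq_big_seq => Z; rewrite fpowersetE => ZL.
  rewrite /H -G_balance// mulrA.
  have [h|h] := pselect (hardcore (patch D Y (spin w))); last by rewrite G_hardcore// !mul0r.
  congr (_ * \1_A _); rewrite /repl; congr thinning.
  by rewrite (spin_repl h) patch_overwrite.
Qed.

Lemma resample_quasilocal : quasilocal resample_kernel.
Proof.
move=> L zeta.
pose Y0 : {fset site d} := [fset val i | i in [fset i : L | zeta i]%fset]%fset.
have Y0P (i : L) : (val i \in Y0) = zeta i.
  apply/imfsetP/idP => [[j /= + /val_inj ->]|zi]; first by rewrite !inE.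
  by exists i => //; rewrite !inE.
have Y0L : Y0 `<=f` L.
  by apply/fsubsetP => x /imfsetP[j _ ->]; exact: valP.
rewrite (_ : (fun w => _) = (fun w => (G L Y0 w)%:E)); last first.
  apply/funext => w; rewrite [LHS]resampleE; congr (_%:E).
  rewrite (bigD1_seq Y0) ?fpowersetE ?fset_uniq//=.
  have E Y : Y `<=f` L -> G L Y w * \1_[set w' | forall i : L, spin w' (val i) = zeta i]
      (repl L Y w) = G L Y w * (Y == Y0)%:R.
    move=> YL; have [h|h] := pselect (hardcore (patch L Y (spin w))); last first.
      by rewrite G_hardcore// !mul0r.
    congr (_ * _); rewrite indicE; congr (nat_of_bool _)%:R.
    apply/idP/eqP => [/set_mem/= hz|YE]; last first.
      by apply: mem_set => /= i; rewrite spin_repl// YE /patch fsvalP Y0P.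
    apply/fsetP => x; have [xL|xL] := boolP (x \in L).
      have := hz [` xL]%fset; rewrite spin_repl// /patch /= xL => ->.
      by rewrite -Y0P.
    by rewrite (negbTE (contra (fsubsetP YL x) xL)) (negbTE (contra (fsubsetP Y0L x) xL)).
  rewrite E// eqxx mulr1 big_seq_cond big1 ?addr0// => Y; rewrite fpowersetE => /andP[YL YY0].
  by rewrite E// (negbTE YY0) mulr0.
have EFin_continuous : continuous (@EFin R).
  by move=> x; apply: cvg_EFin; [exact: nearW|exact: cvg_id].
move=> w; apply: (@continuous_comp _ _ _ (G L Y0) EFin w); last exact: EFin_continuous.
exact: G_continuous.
Qed.

Section dlr.
Variable mu : probability (tconfig d) R.

Definition cylset n (s : site d -> bool) : set (tconfig d) :=
  [set w | forall i, (l1norm i <= n)%N -> spin w i = s i].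

Definition cylprob n s : R := fine (mu (cylset n s)).

Definition pattern n w : {fset site d} := [fset i in ball d n | spin w i]%fset.

Lemma in_pattern n w i : (i \in pattern n w) = (l1norm i <= n)%N && spin w i.
Proof. by rewrite in_sep in_ball. Qed.

Lemma pattern_sub n w : pattern n w `<=f` ball d n.
Proof. exact: fset_sub. Qed.

Lemma eq_cylprob n s t : (forall i, (l1norm i <= n)%N -> s i = t i) ->
  cylprob n s = cylprob n t.
Proof.
move=> st; congr (fine (mu _)); apply/seteqP; split=> w h i ni.
  by rewrite h ?st.
by rewrite h ?st.
Qed.

Lemma measurable_finitely_determined n (A : set (tconfig d)) :
  finitely_determined n A -> measurable A.
Proof. by move/finitely_determined_open/open_measurable_tconfig. Qed.

Lemma cylset_determined n s : finitely_determined n (cylset n s).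
Proof. by move=> w w' ww' h i ni; rewrite -ww' ?h. Qed.

Lemma cylprobK n s : (cylprob n s)%:E = mu (cylset n s).
Proof.
rewrite fineK// fin_num_measure//; apply: (@measurable_finitely_determined n).
exact: cylset_determined.
Qed.

Lemma cylprob_ge0 n s : 0 <= cylprob n s.
Proof. by rewrite -lee_fin cylprobK. Qed.

Lemma cylset_pattern n X w : X `<=f` ball d n ->
  (w \in cylset n (fun i => i \in X)) = (X == pattern n w).
Proof.
move=> XB; apply/idP/eqP => [/set_mem h|->].
  apply/fsetP => i; rewrite in_pattern; have [ni|ni] /= := boolP (l1norm i <= n)%N.
    by rewrite (h i).
  by apply/negbTE; apply: contra ni => /(fsubsetP XB); rewrite in_ball.
by apply: mem_set => i ni; rewrite in_pattern ni.
Qed.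

Lemma integral_pattern n (h : {fset site d} -> R) : (forall X, 0 <= h X) ->
  (\int[mu]_w (h (pattern n w))%:E =
  (\sum_(X <- fpowerset (ball d n)) h X * cylprob n (fun i => i \in X))%:E)%E.
Proof.
move=> h0; transitivity (\int[mu]_w (\sum_(X <- fpowerset (ball d n))
    (h X)%:E * (\1_(cylset n (fun i => i \in X)) w)%:E))%E.
  apply: eq_integral => w _; under eq_bigr do rewrite -EFinM.
  rewrite sumEFin; congr (_%:E).
  rewrite (bigD1_seq (pattern n w)) ?fpowersetE ?fset_uniq ?pattern_sub//=.
  rewrite indicE cylset_pattern ?pattern_sub// eqxx mulr1.
  rewrite big_seq_cond big1 ?addr0// => X; rewrite fpowersetE => /andP[XB XE].
  by rewrite indicE cylset_pattern// (negbTE XE) mulr0.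
have mc X : measurable (cylset n (fun i => i \in X)).
  by apply: (@measurable_finitely_determined n); exact: cylset_determined.
rewrite ge0_integral_sum//; last 2 first.
- move=> X; apply/measurable_EFinP; apply: measurable_funM => //.
- by move=> X w _; rewrite -EFinM lee_fin mulr_ge0.
rewrite -sumEFin; apply: eq_bigr => X _.
rewrite ge0_integralZl_EFin//; last by apply/measurable_EFinP; exact: measurable_indic.
by rewrite integral_indic// setIT EFinM cylprobK.
Qed.

Hypothesis G_dlr : forall L, exists2 e : nat -> R,
  (e n @[n --> \oo] --> (0 : R)) /\ (forall n, 0 <= e n) &
  exists n0, forall w Y n, Y `<=f` L -> (n0 <= n)%N ->
  G L Y w * (\sum_(Y' <- fpowerset L) cylprob n.+1 (patch L Y' (spin w))) <=
  cylprob n.+1 (patch L Y (spin w)) +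
  e n * (\sum_(Y' <- fpowerset L) cylprob n.+1 (patch L Y' (spin w))).

Definition mixture L (A : set (tconfig d)) : \bar R :=
  (\int[mu]_w resample L w A)%E.

Let mixture0 L : mixture L set0 = 0%E.
Proof.
by rewrite /mixture (eq_integral (cst 0%E)) ?integral0// => w _; rewrite measure0.
Qed.

Let mixture_ge0 L A : (0 <= mixture L A)%E.
Proof. by apply: integral_ge0 => w _; exact: measure_ge0. Qed.

Let mixture_sigma_additive L : semi_sigma_additive (mixture L).
Proof.
move=> U mU tU mUU; rewrite [X in _ --> X](_ : _ =
  \int[mu]_w (\sum_(n <oo) resample L w (U n)))%E; last first.
  apply: eq_integral => w _.
  by apply/esym/cvg_lim => //; exact/measure_semi_sigma_additive.
apply/cvg_closeP; split.
  by apply: is_cvg_nneseries => n _ _; exact: integral_ge0.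
rewrite closeE// integral_nneseries// => n.
exact: measurable_resample.
Qed.

HB.instance Definition _ L := isMeasure.Build _ _ R (mixture L)
  (mixture0 L) (mixture_ge0 L) (@mixture_sigma_additive L).

Lemma mixtureT L : mixture L setT = 1%E.
Proof.
rewrite /mixture (eq_integral (cst 1%E)); last by move=> w _; rewrite resampleT.
rewrite integral_cst// mul1e; exact: probability_setT.
Qed.

Lemma cylprob_patch n L Y w : L `<=f` ball d n -> Y `<=f` L ->
  cylprob n (patch L Y (spin w)) =
  cylprob n (fun i => i \in (pattern n w `\` L) `|` Y)%fset.
Proof.
move=> LB YL; apply: eq_cylprob => i ni; rewrite /patch in_fsetU in_fsetD in_pattern ni /=.
have [iL|iL] := boolP (i \in L) => //=.
by rewrite (negbTE (contra (fsubsetP YL i) iL)) orbF.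
Qed.

Lemma sum_cylprob n : \sum_(X <- fpowerset (ball d n)) cylprob n (fun i => i \in X) = 1.
Proof.
have := @integral_pattern n (fun=> 1) (fun=> ler01).
rewrite integral_cst// mul1e => muT.
apply: EFin_inj; rewrite -[RHS](probability_setT mu) [RHS]muT; congr (_%:E).
by apply: eq_bigr => X _; rewrite mul1r.
Qed.

(** On each cylinder of positive mass, the weights G are almost the conditional
    probabilities of mu, for which the equation holds exactly by reversibility.
    An upper bound suffices, since it also applies to the complement. *)
Lemma mixture_le_determined L n1 A : finitely_determined n1 A ->
  (mixture L A <= mu A)%E.
Proof.
move=> An; have mA := measurable_finitely_determined An.
have [e [e0 e_ge0] [n0 dlr]] := G_dlr L.
have [N LN] := fset_l1norm_bound L.
pose card := (size (fpowerset L))%:R : R.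
suff bound n : (n0 <= n)%N -> (n1 <= n)%N -> (N <= n)%N ->
    (mixture L A <= mu A + (card * e n)%:E)%E.
  have fA : mu A \is a fin_num by rewrite fin_num_measure.
  have cA : ((fun n => (mu A + (card * e n)%:E)%E) @ \oo --> mu A)%classic.
    rewrite -[X in (_ --> X)](adde0 (mu A)); apply: cvgeD => //.
      by rewrite fin_num_adde_defl.
      exact: cvg_cst.
    apply: cvg_EFin; first exact: nearW.
    by rewrite -(mulr0 card); apply: cvgMr.
  rewrite -(cvg_lim _ cA)//; apply: lime_ge; first exact: cvgP cA.
  exists (maxn n0 (maxn n1 N)) => // n /=; rewrite !geq_max => /and3P[h1 h2 h3].
  exact: bound.
move=> h0 h1 h2; set m := n.+1; set B := ball d m.
have LB : L `<=f` B.
  by apply/fsubsetP => i /LN iN; rewrite in_ball (leq_trans iN)// (leq_trans h2).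
pose c X := cylprob m (fun i => i \in X).
pose r X Y := ((X `\` L) `|` Y)%fset : {fset site d}.
pose s X := \sum_(Y <- fpowerset L) c (r X Y).
pose a X : R := (`[< exists2 w, pattern m w = X & A w >])%:R.
have a0 X : 0 <= a X by rewrite /a.
have s0 X : 0 <= s X by apply: sumr_ge0 => Y _; exact: cylprob_ge0.
have c_le_s X : c X <= s X.
  have XE : r X (X `&` L)%fset = X.
    by apply/fsetP => i; rewrite !inE; case: (i \in L); case: (i \in X).
  rewrite /s (bigD1_seq (X `&` L)%fset) ?fpowersetE ?fset_uniq ?fsubsetIr//= XE.
  by rewrite lerDl sumr_ge0// => Y _; exact: cylprob_ge0.
(* an upper bound for the redrawn mass of A on the cylinder X; null cylinders
   get the trivial bound, as e n controls nothing there *)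
pose h X := if c X == 0 then 1 else
  \sum_(Y <- fpowerset L) a (r X Y) * (c (r X Y) / s X + e n).
have hge0 X : 0 <= h X.
  rewrite /h; case: ifP => // _; apply: sumr_ge0 => Y _; rewrite mulr_ge0// addr_ge0//.
  by rewrite divr_ge0//; exact: cylprob_ge0.
have step1 w : (resample L w A <= (h (pattern m w))%:E)%E.
  rewrite resampleE lee_fin /h; case: ifPn => [_|cX].
    rewrite -(G_sum1 L w) !big_seq; apply: ler_sum => Y; rewrite fpowersetE => YL.
    by rewrite ler_piMr ?G_ge0// indicE; case: (_ \in _); rewrite ?lexx ?ler01.
  have sX : 0 < s (pattern m w).
    by apply: lt_le_trans (c_le_s _); rewrite lt_neqAle eq_sym cX cylprob_ge0.
  rewrite !big_seq; apply: ler_sum => Y; rewrite fpowersetE => YL.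
  have term0 : 0 <= a (r (pattern m w) Y) * (c (r (pattern m w) Y) / s (pattern m w) + e n).
    by rewrite mulr_ge0// addr_ge0// divr_ge0//; exact: cylprob_ge0.
  have [hY|hY] := pselect (hardcore (patch L Y (spin w))); last by rewrite G_hardcore// mul0r.
  rewrite indicE; have [/set_mem Aw|_] := boolP (repl L Y w \in A); last by rewrite mulr0.
  have -> : a (r (pattern m w) Y) = 1.
    rewrite /a; have -> // : `[< exists2 w', pattern m w' = r (pattern m w) Y & A w' >] = true.
    apply/asboolP; exists (repl L Y w) => //; apply/fsetP => i.
    rewrite in_pattern spin_repl// /patch in_fsetU in_fsetD in_pattern.
    have [iL|iL] := boolP (i \in L) => //=.
      have [iY|iY] := boolP (i \in Y); rewrite ?andbT ?andbF//.
      by rewrite (leq_trans (LN i iL))// (leq_trans h2).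
    by rewrite (negbTE (contra (fsubsetP YL i) iL)) orbF.
  rewrite mulr1 mul1r -(ler_pM2r sX) mulrDl divfK ?gt_eqF//.
  have := dlr w Y n YL h0; rewrite -/m cylprob_patch//.
  rewrite (_ : \sum_(Y' <- fpowerset L) _ = s (pattern m w))//.
  by apply: eq_big_seq => Y'; rewrite fpowersetE => Y'L; rewrite cylprob_patch.
have mpat g : measurable_fun setT (fun w => (g (pattern m w))%:E : \bar R).
  apply/measurable_EFinP => _ U mU; rewrite setTI.
  apply: (@measurable_finitely_determined m) => w w' ww' /=.
  rewrite (_ : pattern m w = pattern m w')//; apply/fsetP => i; rewrite !in_pattern.
  by case: leqP => //= ni; rewrite ww'.
have step2 : (mixture L A <= (\sum_(X <- fpowerset B) h X * c X)%:E)%E.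
  rewrite -integral_pattern//; apply: ge0_le_integral => //.
  by apply: measurable_resample.
have step3 : ((\sum_(X <- fpowerset B) a X * c X)%:E <= mu A)%E.
  have -> : mu A = (\int[mu]_w (\1_A w)%:E)%E by rewrite integral_indic// setIT.
  rewrite -integral_pattern//.
  have mI : measurable_fun setT (fun w => (\1_A w)%:E : \bar R).
    by apply/measurable_EFinP; exact: measurable_indic.
  apply: ge0_le_integral => //; first by move=> w _; rewrite lee_fin.
  move=> w _; rewrite lee_fin /a indicE; case: asboolP => [[w' ww' Aw']|_]; last by rewrite ler0n.
  rewrite mem_set//; apply: An Aw' => i ni.
  have im : (l1norm i <= m)%N by apply: leq_trans ni (leq_trans h1 _).
  by have := in_pattern m w' i; rewrite ww' in_pattern im.
apply: le_trans step2 (le_trans _ (leeD2r _ step3)); rewrite -EFinD lee_fin.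
have cge0 X : 0 <= c X by exact: cylprob_ge0.
apply: (@le_trans _ _ (\sum_(X <- fpowerset B)
    (\sum_(Y <- fpowerset L) a (r X Y) * (c (r X Y) * c X / s X) + card * e n * c X))).
  apply: ler_sum => X _; rewrite /h; case: ifPn => [/eqP ->|cX].
    rewrite !mulr0 addr0 sumr_ge0// => Y _.
    by rewrite mulr0 mul0r mulr0.
  rewrite mulr_suml (_ : card * e n * c X = \sum_(Y <- fpowerset L) e n * c X); last first.
    by rewrite big_const_seq count_predT iter_addr_0 -mulrA mulr_natl.
  rewrite -big_split /=; apply: ler_sum => Y _.
  rewrite mulrDr mulrDl; apply: lerD.
    by rewrite -mulrA; rewrite le_eqVlt; apply/orP; left; apply/eqP; rewrite mulrAC.
  rewrite -mulrA ler_piMl ?mulr_ge0// /a.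
  by case: asboolP => _; rewrite ?lexx ?ler01.
rewrite big_split /= -mulr_sumr sum_cylprob mulr1 lerD2r.
rewrite (sum_resample (fun X Y => a (r X Y) * (c (r X Y) * c X / s X)) LB).
rewrite !big_seq; apply: ler_sum => X _.
apply: (@le_trans _ _ (\sum_(Y <- fpowerset L) a X * (c X * c (r X Y) / s X))).
  rewrite !big_seq; apply: ler_sum => Y; rewrite fpowersetE => YL.
  have -> : r (X `\` L `|` Y)%fset (X `&` L)%fset = X.
    apply/fsetP => i; rewrite !inE; have [iL|iL] := boolP (i \in L); rewrite ?andbF ?andbT//=.
    by rewrite (negbTE (contra (fsubsetP YL i) iL)); case: (i \in X).
  rewrite (_ : s (X `\` L `|` Y)%fset = s X)//.
  apply: eq_big_seq => Y'; rewrite fpowersetE => Y'L; congr c; apply/fsetP => i.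
  rewrite !inE; have [iL|iL] := boolP (i \in L) => //=.
  by rewrite (negbTE (contra (fsubsetP YL i) iL)) orbF.
rewrite -mulr_sumr ler_wpM2l// -mulr_suml -mulr_sumr -mulrA ler_piMr//.
rewrite -/(s X); have [->|sX] := eqVneq (s X) 0; first by rewrite mul0r.
by rewrite divff.
Qed.

Lemma mixture_determined L n1 A : finitely_determined n1 A -> mixture L A = mu A.
Proof.
move=> An; have mA := measurable_finitely_determined An.
have AnC : finitely_determined n1 (~` A).
  by move=> w w' ww' nA Aw'; apply: nA; apply: An Aw' => i /ww'.
have le1 := mixture_le_determined L An; have le2 := mixture_le_determined L AnC.
have sum1 (nu : {measure set tconfig d -> \bar R}) : (nu setT = 1 -> nu A + nu (~` A) = 1)%E.
  by move=> <-; rewrite -measureU ?setUv// ?setICr//; exact: measurableC.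
have m1 := sum1 (mixture L) (mixtureT L); have m2 := sum1 mu (probability_setT mu).
exact: eq_of_le_total (mixture_ge0 _ _) (mixture_ge0 _ _) le1 le2 m1 m2.
Qed.

(** The sets determined by finitely many spins are stable under intersection
    and generate the Borel sigma-algebra. *)
Lemma mixture_DLR : DLR resample_kernel mu.
Proof.
move=> L A mA.
pose dset : set (set (tconfig d)) := [set U | exists n, finitely_determined n U].
have dsetm : dset `<=` measurable.
  by move=> U [n Un]; exact: measurable_finitely_determined Un.
apply: (@g_sigma_algebra_measure_unique _ R _ dset dsetm (fun=> setT) _ _
  (mixture L) mu) => //.
- by move=> _; exists 0%N.
- by apply/seteqP; split=> // x _; exists 0%N.
- move=> U V [n Un] [m Vm]; exists (maxn n m) => w w' ww' [Uw Vw]; split.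
    by apply: Un Uw => i ni; apply: ww'; rewrite (leq_trans ni)// leq_maxl.
  by apply: Vm Vw => i ni; apply: ww'; rewrite (leq_trans ni)// leq_maxr.
- by move=> U [n Un]; exact: mixture_determined Un.
- by move=> _; rewrite [X in (X < _)%E](mixtureT L) ltry.
(* an open set is the union of the finitely determined sets it contains *)
move: A mA; apply: smallest_sub; first exact: smallest_sigma_algebra.
move=> U oU.
pose Un n := [set w | near_cyl n w `<=` U].
have -> : U = \bigcup_n Un n.
  apply/seteqP; split=> [w Uw|w [n _ /(_ w)]]; last by apply.
  by have [n nU] := near_cyl_sub oU Uw; exists n.
apply: (@bigcupT_measurable _ (g_sigma_algebraType dset)) => n.
apply: sub_sigma_algebra; exists n => w w' ww' wU v v'w; apply: wU => i ni.
by rewrite v'w// ww'.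
Qed.

(** A measure is Gibbs as soon as its conditional weights in finite regions are
    approximated, uniformly in the configuration, by continuous weights G that
    satisfy the algebraic relations of conditional probabilities. *)
Lemma gibbs_of_weights : gibbs mu.
Proof.
exists resample_kernel; split.
- exact: resample_specification.
- exact: resample_quasilocal.
- exact: mixture_DLR.
Qed.

End dlr.

End weights_to_specification.

(** * The law of the thinned Bernoulli field *)

Section thinned_law.
Variables (R : realType) (d : nat) (p : R) (mu : probability (config d) R).
Hypothesis mu_p : bernoulli_product p mu.
Implicit Types (V X L Y : {fset site d}).

Definition config_of_fset X : config d := fun i => i \in X.

Definition ccyl V X : set (config d) := [set w | forall i, i \in V -> w i = (i \in X)].

Lemma measurable_ccyl V X : measurable (ccyl V X).
Proof.
apply: sub_sigma_algebra; rewrite /= openE => w wX.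
have : \forall w' \near w,
    (\bigcap_(i in [set` V]) [set v : config d | v i = w i]) w'.
  by apply: filter_bigI => i _; exact: config_near.
by apply: filterS => w' h i iV; rewrite (h i iV) wX.
Qed.

Lemma bernoulli_ccyl V X : (X `<=` V)%fset ->
  mu (ccyl V X) = (p ^+ #|` X| * (1 - p) ^+ #|` (V `\` X)%fset|)%:E.
Proof.
move=> XV; have := mu_p [ffun i : V => val i \in X].
have -> : [set w : config d | forall i : V, w (val i) = [ffun i : V => val i \in X] i] =
    ccyl V X.
  apply/seteqP; split=> w /= h i; last by rewrite ffunE h// fsvalP.
  by move=> iV; have := h [` iV]%fset; rewrite ffunE.
move=> ->; congr (_%:E).
under eq_bigr do rewrite ffunE.
rewrite -(big_seq_fsetE _ V predT (fun i => if i \in X then p else 1 - p))/=.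
rewrite (bigID (mem X))/=.
rewrite (eq_bigr (fun=> p)); last by move=> i ->.
rewrite [X in _ * X](eq_bigr (fun=> 1 - p)); last by move=> i /negbTE ->.
rewrite -[X in X * _]big_filter -[X in _ * X]big_filter !big_const_seq.
rewrite !count_predT !iter_mulr_1; congr (_ ^+ _ * _ ^+ _).
  apply: perm_size; apply: uniq_perm; rewrite ?filter_uniq ?fset_uniq// => i.
  by rewrite mem_filter /=; have [/(fsubsetP XV) ->|] := boolP (i \in X).
apply: perm_size; apply: uniq_perm; rewrite ?filter_uniq ?fset_uniq// => i.
by rewrite mem_filter inE.
Qed.

Lemma bernoulli_local_event V (A : set (config d)) : measurable A ->
  (forall w w', (forall i, i \in V -> w i = w' i) -> A w -> A w') ->
  mu A = (bern p V (fun X => (config_of_fset X \in A)%:R))%:E.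
Proof.
move=> mA AV.
transitivity (\int[mu]_w (\sum_(X <- fpowerset V)
    ((config_of_fset X \in A)%:R)%:E * (\1_(ccyl V X) w)%:E))%E.
  have -> : mu A = (\int[mu]_w (\1_A w)%:E)%E by rewrite integral_indic// setIT.
  apply: eq_integral => w _; under eq_bigr do rewrite -EFinM.
  rewrite sumEFin; congr (_%:E).
  pose X0 := [fset i in V | w i]%fset.
  have X0E i : (i \in X0) = (i \in V) && w i by rewrite in_sep.
  have X0V : (X0 `<=` V)%fset by exact: fset_sub.
  have cE X : (X `<=` V)%fset -> (w \in ccyl V X) = (X == X0).
    move=> XV; apply/idP/eqP => [/set_mem h|->].
      apply/fsetP => i; rewrite X0E; have [iV|iV] := boolP (i \in V).
        by rewrite h.
      by apply/negbTE; apply: contra iV => /(fsubsetP XV).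
    by apply: mem_set => i iV; rewrite X0E iV.
  rewrite (bigD1_seq X0) ?fpowersetE ?fset_uniq//=.
  rewrite [X in _ = _ + X]big_seq_cond big1 ?addr0; last first.
    move=> X; rewrite fpowersetE => /andP[XV XX0].
    by rewrite indicE cE// (negbTE XX0) mulr0.
  rewrite !indicE cE// eqxx mulr1; congr (nat_of_bool _)%:R.
  apply/idP/idP => /set_mem h; apply: mem_set; apply: AV h => i iV;
  by rewrite /config_of_fset X0E iV.
have mI X : measurable_fun setT (fun w => (\1_(ccyl V X) w)%:E : \bar R).
  by apply/measurable_EFinP; apply: measurable_indic; exact: measurable_ccyl.
rewrite ge0_integral_sum; first last.
- by move=> X w _; rewrite -EFinM lee_fin mulr_ge0// indicE.
- by move=> X; exact: measurable_funeM.
- by [].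
rewrite /bern -sumEFin; apply: eq_big_seq => X; rewrite fpowersetE => XV.
rewrite ge0_integralZl_EFin//.
rewrite integral_indic//; last exact: measurable_ccyl.
rewrite setIT [X in (_ * X = _)%E](bernoulli_ccyl XV).
by rewrite -EFinM mulrC.
Qed.

Lemma thin_config_of_fset X i : thin (config_of_fset X) i = thin_fset X i.
Proof.
rewrite /thin /thin_fset; congr (_ && _); apply/asboolP/fdisjointP => h j.
  by rewrite in_nb => /h; rewrite /config_of_fset => ->.
by rewrite -in_nb => /h /negbTE.
Qed.

Lemma thinned_cylprob n s : cylprob (thinned_measure mu) n s = cyl_weight p n s.
Proof.
apply: EFin_inj; rewrite cylprobK.
have mC : measurable (cylset n s).
  by apply: (@measurable_finitely_determined _ n); exact: cylset_determined.
have mT : measurable (@thinning d @^-1` cylset n s).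
  by rewrite -[X in measurable X]setTI; exact: measurable_thinning.
rewrite [LHS](_ : _ = mu (@thinning d @^-1` cylset n s))//.
rewrite (bernoulli_local_event (V := ball d n.+1))//; last first.
  move=> w w' ww' h i ni; rewrite -(h i ni) !spin_thinning /thin.
  have e j : (l1norm j <= n.+1)%N -> w' j = w j by move=> jn; rewrite ww' ?in_ball.
  rewrite e; last exact: leqW.
  congr (_ && _); apply: asbool_equiv_eq; split=> h1 j ij; have := h1 j ij;
    rewrite e//; (have : (l1norm j <= l1norm i + 1)%N by apply: l1norm_nb; rewrite in_nb nn_sym);
    by move=> /leq_trans; apply; rewrite addn1.
congr (_%:E); apply: eq_bern => X _; congr (nat_of_bool _)%:R.
apply/idP/agreeP => [/set_mem h i ni|h].
  by rewrite -(h i ni) spin_thinning thin_config_of_fset.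
by apply: mem_set => i ni; rewrite spin_thinning thin_config_of_fset h.
Qed.

End thinned_law.

Section open_interval.
Variables (R : realType) (d : nat) (p : R) (mu : probability (config d) R).
Hypotheses (mu_p : bernoulli_product p mu) (p0 : 0 < p) (p1 : p < 1).
Hypothesis sub : subcritical d p.
Local Notation G := (fun L Y (w : tconfig d) => lim_weight p L Y (spin w)).

Lemma cond_weight_local n L Y (s t : site d -> bool) :
  (forall i, (l1norm i <= n)%N -> s i = t i) -> cond_weight p n L Y s = cond_weight p n L Y t.
Proof.
move=> st; have e Y' : cyl_weight p n (patch L Y' s) = cyl_weight p n (patch L Y' t).
  by apply: eq_cyl_weight => i ni; rewrite /patch; case: ifP => // _; exact: st.
by rewrite /cond_weight /cyl_total e; congr (_ / _); apply: eq_bigr.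
Qed.

(** A uniform limit of functions of finitely many spins is continuous. *)
Lemma lim_weight_continuous L Y : (Y `<=` L)%fset -> continuous (G L Y).
Proof.
move=> YL w.
apply: (@cvgrPdist_le _ _ _ (nbhs w) (nbhs_filter w) _ _).2 => eps eps0.
have [e e0 [n0 rate]] := cond_weight_rate p0 p1 sub L.
have /cvgrPdist_lt/(_ (eps / 2)) [|N _ hN] := e0; first by rewrite divr_gt0.
pose n := maxn n0 N.
have en : e n <= eps / 2.
  have := hN n (leq_maxr _ _); rewrite sub0r normrN => /ltW; apply: le_trans.
  exact: ler_norm.
apply: filterS (nbhs_near_cyl n.+1 w) => w' ww'.
have h1 := rate _ _ (@spin_hardcore d w) YL n (leq_maxl _ _).
have h2 := rate _ _ (@spin_hardcore d w') YL n (leq_maxl _ _).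
have e1 : cond_weight p n.+1 L Y (spin w') = cond_weight p n.+1 L Y (spin w).
  exact: cond_weight_local.
rewrite e1 in h2; rewrite (splitr eps).
apply: le_trans (ler_distD (cond_weight p n.+1 L Y (spin w)) _ _) (lerD _ _).
  by rewrite distrC; apply: le_trans h1 en.
exact: le_trans h2 en.
Qed.

(** The limits of the conditional weights of the thinned measure meet the
    criterion; patterns with adjacent ones have limit zero and are treated
    apart, because resampling would then leave the hard-core configurations. *)
Lemma subcritical_gibbs : gibbs (thinned_measure mu).
Proof.
apply: (@gibbs_of_weights R d G).
- by move=> L Y w YL; apply: lim_weight_ge0 => //; exact: spin_hardcore.
- by move=> L w; apply: sum_lim_weight => //; exact: spin_hardcore.
- by move=> L Y w YL; apply: lim_weight_not_hardcore => //; exact: spin_hardcore.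
- move=> L Y w w' YL ww'; rewrite /lim_weight.
  congr (lim (_ @ \oo)); apply/funext => n.
  have e Y' : patch L Y' (spin w) = patch L Y' (spin w').
    by apply/funext => i; rewrite /patch; case: ifPn => // /ww'.
  by rewrite /cond_weight /cyl_total e; congr (_ / _); apply: eq_bigr => Y' _; rewrite e.
- exact: lim_weight_continuous.
- move=> L D Y Z w LD YD ZL; set Y' := (Y `\` L `|` Z)%fset.
  have Y'D : (Y' `<=` D)%fset.
    by rewrite fsubUset (fsubset_trans ZL LD) andbT (fsubset_trans _ YD)// fsubsetDl.
  have hw := @spin_hardcore d w.
  have nothc (A B : {fset site d}) s : hardcore s -> (B `<=` A)%fset -> ~ hardcore (patch A B s) ->
    lim_weight p A B s = 0 by exact: lim_weight_not_hardcore.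
  have Y'E : (Y' `\` L `|` Y `&` L)%fset = Y.
    apply/fsetP => i; rewrite !inE; have [iL|iL] := boolP (i \in L).
      by rewrite andbT.
    by rewrite (negbTE (contra (fsubsetP ZL i) iL)) /= andbF !orbF.
  have [h1|h1] := pselect (hardcore (patch D Y (spin w))); last first.
    rewrite (nothc _ _ _ hw YD h1)// mul0r.
    have [h2|h2] := pselect (hardcore (patch D Y' (spin w))); last first.
      by rewrite (nothc _ _ _ hw Y'D h2)// mul0r.
    rewrite (spin_repl h2) (nothc L (Y `&` L)%fset) ?mulr0//.
      exact: fsubsetIr.
    by rewrite patch_overwrite ?fsubsetIr// Y'E.
  rewrite (spin_repl h1).
  have [h2|h2] := pselect (hardcore (patch D Y' (spin w))); last first.
    rewrite (nothc _ _ _ hw Y'D h2)// mul0r.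
    rewrite (nothc L Z) ?mulr0//.
    by rewrite patch_overwrite.
  rewrite (spin_repl h2); exact: lim_weight_balance.
- move=> L; have [e e0 [n0 rate]] := cond_weight_rate p0 p1 sub L.
  exists (fun n => `|e n|).
    by split=> //; rewrite -[X in _ --> X](normr0 R); exact: cvg_norm.
  exists n0 => w Y n YL nn.
  have hw := @spin_hardcore d w.
  rewrite (thinned_cylprob mu_p).
  have -> : \sum_(Y' <- fpowerset L) cylprob (thinned_measure mu) n.+1 (patch L Y' (spin w)) =
      cyl_total p n.+1 L (spin w).
    by apply: eq_bigr => Y' _; rewrite (thinned_cylprob mu_p).
  have S0 := cyl_total_gt0 p0 p1 n.+1 L hw.
  have : lim_weight p L Y (spin w) <= cond_weight p n.+1 L Y (spin w) + `|e n|.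
    have := rate _ _ hw YL n nn; rewrite ler_distl => /andP[_].
    by move=> h; have := ler_norm (e n); have := rate _ _ hw YL n nn; rewrite ler_norml; lra.
  move=> /(ler_wpM2r (ltW S0)) /le_trans; apply.
  by rewrite mulrDl /cond_weight divfK// gt_eqF.
Qed.

End open_interval.

Section endpoints.
Variables (R : realType) (d : nat) (p : R) (mu : probability (config d) R).
Hypothesis mu_p : bernoulli_product p mu.
Hypothesis d1 : (1 <= d)%N.
Hypothesis p01 : p = 0 \/ p = 1.

Lemma exists_nn (i : site d) : exists2 j, nn i j & (l1norm j <= (l1norm i).+1)%N.
Proof.
pose k := Ordinal d1; pose j : site d := i + delta_mx 0 k.
have ij : nn i j.
  apply/eqP; rewrite (bigD1 k)//= big1 => [|l lk]; rewrite !mxE ?eqxx /=.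
    by rewrite opprD addNKr.
  by rewrite (negbTE lk) addr0 subrr normr0.
exists j => //; rewrite -addn1; apply: l1norm_nb.
by rewrite in_nb nn_sym.
Qed.

(** For p equal to 0 or 1 the Bernoulli configuration is constant and, as every
    site has a neighbour, it thins to zero everywhere. *)
Lemma cyl_weight_endpoint n (s : site d -> bool) :
  cyl_weight p n s = (all (fun i => ~~ s i) (ball d n))%:R.
Proof.
pose V := ball d n.+1.
have [X0 X0V [fX fE]] : exists2 X0, (X0 `<=` V)%fset &
    (forall i, (l1norm i <= n)%N -> thin_fset X0 i = false) /\
    forall f, bern p V f = f X0.
  case: p01 => ->.
    exists fset0; rewrite ?fsub0set//; split=> [i _|f]; first by rewrite /thin_fset inE.
    rewrite /bern (bigD1_seq fset0) ?fpowersetE ?fsub0set ?fset_uniq//.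
    rewrite cardfs0 expr0 subr0 expr1n !mul1r big1; first by rewrite /= addr0.
    by move=> X X0; rewrite expr0n cardfs_eq0 (negbTE X0) !mul0r.
  exists V; rewrite ?fsubset_refl//; split=> [i ni|f].
    rewrite /thin_fset; apply/negbTE/negP => /andP[_ /fdisjointP h].
    have [j ij nj] := exists_nn i; have := h j; rewrite in_nb ij in_ball => /(_ isT)/negP.
    by apply; rewrite (leq_trans nj).
  rewrite /bern (bigD1_seq V) ?fpowersetE ?fsubset_refl ?fset_uniq//.
  rewrite fsetDv cardfs0 expr0 expr1n !mul1r big_seq_cond big1; first by rewrite /= addr0.
  move=> X; rewrite fpowersetE => /andP[XV XneV].
  rewrite subrr expr0n cardfs_eq0 fsetD_eq0 (_ : (V `<=` X)%fset = false) ?mulr0 ?mul0r//.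
  by apply/negbTE; apply: contra XneV => VX; rewrite eqEfsubset XV.
rewrite /cyl_weight fE; congr (nat_of_bool _)%:R; apply/agreeP/allP => h i.
  by rewrite in_ball => ni; rewrite -h// fX.
by move=> ni; rewrite fX//; apply/esym/negbTE/h; rewrite in_ball.
Qed.

(** The thinned measure is the Dirac mass at zero, and the kernel that sets all
    spins of L to zero is a specification for it. *)
Lemma endpoint_gibbs : gibbs (thinned_measure mu).
Proof.
apply: (@gibbs_of_weights R d (fun L Y w => (Y == fset0)%:R)).
- by [].
- move=> L w; rewrite (bigD1_seq fset0) ?fpowersetE ?fsub0set ?fset_uniq//=.
  by rewrite ?eqxx big1 ?addr0// => Y /negbTE ->.
- move=> L Y w YL hY; have [YE|//] := eqVneq Y fset0.
  by case: hY; rewrite YE; apply: hardcore_patch0; exact: spin_hardcore.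
- by [].
- by move=> L Y YL; exact: cst_continuous.
- move=> L D Y Z w LD YD ZL; rewrite -!natrM !mulnb; congr (nat_of_bool _)%:R.
  apply/andP/andP => -[/eqP h1 /eqP h2].
    by rewrite h1 h2 fset0D fset0U fset0I.
  have YE : Y = fset0.
    by rewrite -(fsetID L Y) h2 fset0U; apply/eqP; move/eqP: h1; rewrite fsetU_eq0 => /andP[].
  by move/eqP: h1; rewrite fsetU_eq0 YE eqxx => /andP[_ ->].
- move=> L; exists (fun=> 0); first by split=> //; exact: cvg_cst.
  have [N LN] := fset_l1norm_bound L.
  exists N => w Y n YL Nn; rewrite mul0r addr0.
  have [YE|_] := eqVneq Y fset0; last by rewrite mul0r cylprob_ge0.
  rewrite mul1r (bigD1_seq fset0) ?fpowersetE ?fsub0set ?fset_uniq//= YE.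
  rewrite big_seq_cond big1 ?addr0// => Y'; rewrite fpowersetE => /andP[Y'L /fset0Pn[i iY']].
  rewrite (thinned_cylprob mu_p) cyl_weight_endpoint.
  have -> // : all (fun i => ~~ patch L Y' (spin w) i) (ball d n.+1) = false.
  apply/negbTE/allPn; exists i.
    by rewrite in_ball (leq_trans (LN i (fsubsetP Y'L _ iY')))// leqW.
  by rewrite /patch (fsubsetP Y'L _ iY') iY'.
Qed.

End endpoints.

(** * The two parameter regimes *)

Section regimes.
Variable R : realType.

Lemma bernoulli_inequality (p : R) n : 0 <= p -> p <= 1 ->
  1 - n%:R * p <= (1 - p) ^+ n.
Proof.
move=> p0 p1; elim: n => [|n IH]; first by rewrite expr0 mul0r subr0.
rewrite exprS -natr1; have [h|h] := leP 0 (1 - n%:R * p).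
  have n0 : 0 <= n%:R :> R by []; nra.
have : 0 <= (1 - p) * (1 - p) ^+ n by rewrite -exprS exprn_ge0// subr_ge0.
nra.
Qed.

(** The number of clauses is at most 4 d^2 and the weight of an isolated one at
    most p, while the weight it is compared with is at least q^(2d+1), which
    the Bernoulli inequality keeps away from zero. *)
Lemma subcritical_small d (p : R) : (1 <= d)%N ->
  0 <= p <= 1 / (16 * d%:R ^+ 2) -> subcritical d p.
Proof.
move=> d1 /andP[p0 pd]; exists (1 / 2); first by apply/andP; split; lra.
move=> a ad.
have D1 : 1 <= d%:R :> R by rewrite ler1n.
set D := d%:R : R in pd D1.
have pD : 16 * D ^+ 2 * p <= 1.
  by move: pd; rewrite ler_pdivlMr 1?mulrC//; nra.
have p1 : p <= 1 by nra.
have qa0 : 0 <= (1 - p) ^+ a by rewrite exprn_ge0// subr_ge0.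
have qa1 : (1 - p) ^+ a <= 1 by rewrite exprn_ile1 ?subr_ge0// gerBl.
have aD : a%:R <= 2 * D by rewrite -natrM ler_nat.
have a0 : 0 <= a%:R :> R by [].
have := bernoulli_inequality a.+1 p0 p1.
set Q := (1 - p) ^+ a.+1; set q := (1 - p) ^+ a in qa0 qa1 *.
rewrite !natrM -/D -natr1 => hQ.
have pq : p * q <= p by rewrite ler_piMr.
have pq0 : 0 <= p * q by rewrite mulr_ge0.
have h1 : 2 * D * a%:R * (p * q) <= 4 * D ^+ 2 * p.
  apply: (@le_trans _ _ (2 * D * (2 * D) * p)); last by nra.
  by rewrite ler_pM ?mulr_ge0 ?ler_wpM2l// ?mulr_ge0; lra.
have h2 : (a%:R + 1) * p <= 3 * D ^+ 2 * p.
  by rewrite ler_wpM2r//; nra.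
nra.
Qed.

(** For q at most 1/2 the number a q^a is at most q and the bracket increases
    with a, so that one neighbour is the worst case. There the condition reads
    2 d p q < 1 - 2 p q, and it follows because p (1 - p q) <= 1 - 2 p q. *)
Lemma subcritical_large d (p : R) : (1 <= d)%N -> 1 / 2 <= p -> p < 1 ->
  2 * d%:R * (1 - p) < 1 - p * (1 - p) -> subcritical d p.
Proof.
move=> d1 ph p1 hp.
have D1 : 1 <= d%:R :> R by rewrite ler1n.
set D := d%:R : R in hp D1.
set q := 1 - p in hp *.
have q0 : 0 < q by rewrite /q; lra.
have qh : q <= 1 / 2 by rewrite /q; lra.
have pE : p = 1 - q by rewrite /q; ring.
have den0 : 0 < 1 - 2 * (p * q) by rewrite pE; nra.
have p0 : 0 < p by lra.
have low : 2 * D * (p * q) < 1 - 2 * (p * q).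
  have : p * (2 * D * q) < p * (1 - p * q) by rewrite ltr_pM2l.
  have : 0 <= q * q ^+ 2 by rewrite mulr_ge0 ?exprn_ge0 ?ltW.
  by rewrite pE; nra.
exists (2 * D * (p * q) / (1 - 2 * (p * q))).
  rewrite divr_ge0 ?(ltW den0) ?mulr_ge0 ?ltW//=; last by lra.
  by rewrite ltr_pdivrMr// mul1r.
move=> a _; have qa0 n : 0 <= q ^+ n by rewrite exprn_ge0// ltW.
case: a => [|a].
  rewrite muln0 mul0r expr0 expr1 mulr1 mulr_ge0 ?divr_ge0 ?(ltW den0)//.
    by rewrite !mulr_ge0 ?ltW//; lra.
  by rewrite addrAC subrr add0r ltW.
have aq : a.+1%:R * q ^+ a <= 1.
  elim: a => [|a IH]; first by rewrite expr0 mulr1.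
  rewrite exprS -natr1; have := qa0 a; have : 0 <= a%:R :> R by [].
  rewrite -natr1 in IH *; set x := q ^+ a in IH *; set y := a%:R in IH * => y0 x0.
  have : 0 <= (y + 1) * x by rewrite mulr_ge0//; lra.
  by nra.
have aq' : a.+1%:R * q ^+ a.+1 <= q.
  by rewrite exprS mulrCA ler_piMr// ltW.
have qaq : q ^+ a.+1 <= q.
  by rewrite exprS ler_piMr ?(ltW q0)// exprn_ile1 ?(ltW q0)//; lra.
rewrite mulrAC ler_pdivlMr// natrM natrM -/D.
have h1 : p * q ^+ a.+1 - q ^+ a.+2 <= p * q - q * q.
  have : 0 <= (p - q) * (q - q ^+ a.+1) by rewrite mulr_ge0 ?subr_ge0//; lra.
  rewrite [q ^+ a.+2]exprS; lra.
have h2 : 1 - 2 * (p * q) <= p + q ^+ a.+2 - p * q ^+ a.+1.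
  by rewrite pE in h1 *; nra.
have h3 : 2 * D * a.+1%:R * (p * q ^+ a.+1) <= 2 * D * (p * q).
  rewrite -mulrA ler_wpM2l; [|lra|]; first by lra.
  by rewrite mulrCA ler_wpM2l// ltW.
apply: ler_pM => //; last exact: ltW.
by rewrite !mulr_ge0// ltW.
Qed.

Definition pcd_expr (d : nat) (p : R) : R := let D : R := d%:R in
  2 * (D - 1) * (D - 2) * (1 - p ^+ 2) + 4 * (D - 1) * p * (1 - p)
    + 2 * ((1 - p) / (1 - p * (1 - p))) + 6 * (D - 1) * (1 - p).

Lemma natr_falling_ge0 (d : nat) : 0 <= (d%:R - 1) * (d%:R - 2) :> R.
Proof.
case: d => [|[|d]]; [lra|lra|].
by rewrite -!natrB// mulr_ge0.
Qed.

(** Since p q <= 1/4, the fraction q / (1 - p q) is at most 4 q / 3. So the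
    last two terms already dominate 2 d q / (1 - p q), and the first two are
    nonnegative. *)
Lemma pcd_expr_lt1 d (p : R) : (1 <= d)%N -> 0 < p < 1 -> pcd_expr d p < 1 ->
  2 * d%:R * (1 - p) < 1 - p * (1 - p).
Proof.
move=> d1 /andP[p0 p1]; rewrite /pcd_expr.
have D1 : 1 <= d%:R :> R by rewrite ler1n.
have := natr_falling_ge0 d; set D := d%:R : R in D1 *.
set q := 1 - p => DD.
have q0 : 0 < q by rewrite /q; lra.
have pq : p * q <= 1 / 4 by have := sqr_ge0 (p - 1 / 2); rewrite /q; lra.
set u := q / (1 - p * q).
have uE : u * (1 - p * q) = q by rewrite /u divfK//; apply/eqP; lra.
have u0 : 0 < u by rewrite divr_gt0//; lra.
have uq : 3 * u <= 4 * q by nra.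
have t1 : 0 <= 2 * (D - 1) * (D - 2) * (1 - p ^+ 2).
  rewrite -mulrA -mulrA mulr_ge0// mulrA mulr_ge0//; nra.
have t2 : 0 <= 4 * (D - 1) * p * q by rewrite !mulr_ge0//; lra.
move=> F1.
have h : 2 * D * u < 1.
  have h1 : 0 <= (D - 1) * (4 * q - 3 * u) by apply: mulr_ge0; lra.
  have h2 : 0 <= (D - 1) * q by apply: mulr_ge0; lra.
  lra.
rewrite -{1}uE mulrA -[ltRHS]mul1r ltr_pM2r//; lra.
Qed.

Lemma pcd_expr_ge_half d (p : R) : (1 <= d)%N -> 0 < p < 1 -> pcd_expr d p < 1 ->
  1 / 2 <= p.
Proof.
move=> d1 p01 /(pcd_expr_lt1 d1 p01); have /andP[p0 p1] := p01.
have D1 : 1 <= d%:R :> R by rewrite ler1n.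
nra.
Qed.

Lemma pcd_expr_near1 d : (1 <= d)%N ->
  let p : R := 1 - 1 / (32 * d%:R ^+ 2) in 0 < p < 1 /\ pcd_expr d p < 1.
Proof.
move=> d1 p; have D1 : 1 <= d%:R :> R by rewrite ler1n.
have DD := natr_falling_ge0 d.
rewrite /pcd_expr; set D := d%:R : R in D1 DD p *.
have D2 : 1 <= D ^+ 2 by nra.
set q := 1 / (32 * D ^+ 2) in p *.
have qE : 32 * D ^+ 2 * q = 1 by rewrite /q mulrC divfK//; apply/eqP; nra.
have q0 : 0 < q by rewrite divr_gt0//; nra.
have q1 : q <= 1 / 32 by nra.
have pE : 1 - p = q by rewrite /p; ring.
split; first by rewrite /p; lra.
rewrite pE; set u := q / _.
have pq : p * q <= 1 / 4 by have := sqr_ge0 (p - 1 / 2); rewrite -pE; lra.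
have uE : u * (1 - p * q) = q by rewrite /u divfK//; apply/eqP; lra.
have u0 : 0 < u by rewrite divr_gt0//; lra.
have uq : 3 * u <= 4 * q by nra.
have p2 : 1 - p ^+ 2 <= 2 * q by rewrite /p; nra.
have Dq : D * q <= D ^+ 2 * q by rewrite ler_wpM2r//; nra.
have qD : q <= D ^+ 2 * q by rewrite ler_peMl// ltW.
have t1 : 2 * (D - 1) * (D - 2) * (1 - p ^+ 2) <= 4 * (D ^+ 2 * q).
  apply: (@le_trans _ _ (2 * ((D - 1) * (D - 2)) * (2 * q))).
    by rewrite -[2 * (D - 1) * _]mulrA ler_wpM2l// mulr_ge0.
  nra.
have t2 : 4 * (D - 1) * p * q <= 4 * (D ^+ 2 * q).
  have : (D - 1) * p * q <= D * q.
    by rewrite ler_wpM2r ?ltW// /p; nra.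
  by nra.
have t3 : 6 * (D - 1) * q <= 6 * (D ^+ 2 * q) by nra.
nra.
Qed.

Lemma pcd_lt1 d : (1 <= d)%N -> pcd R d < 1.
Proof.
move=> d1; have /= [p01 h] := pcd_expr_near1 d1; have /andP[_] := p01.
apply: le_lt_trans; apply: ge_inf; last by split.
by exists 0 => x [/andP[/ltW]].
Qed.

Lemma half_le_pcd d : (1 <= d)%N -> 1 / 2 <= pcd R d.
Proof.
move=> d1; have /= [p01 h] := pcd_expr_near1 d1.
apply: lb_le_inf; first by exists (1 - 1 / (32 * d%:R ^+ 2)); split.
by move=> x [x01 hx]; exact: pcd_expr_ge_half hx.
Qed.

(** Some p' < p satisfies the defining inequality of the threshold; the
    consequence 2 d q' < 1 - p' q' is inherited by larger p, because
    2 d q + q - q^2 increases with q. *)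
Lemma subcritical_above_pcd d (p : R) : (1 <= d)%N -> pcd R d < p -> p < 1 ->
  subcritical d p.
Proof.
move=> d1 dp p1; have /= [p01 h] := pcd_expr_near1 d1.
have [|p' [p'01 hp'] p'p] := inf_lt _ dp.
  by exists (1 - 1 / (32 * d%:R ^+ 2)); split.
have ph := pcd_expr_ge_half d1 p'01 hp'.
have := pcd_expr_lt1 d1 p'01 hp'.
have D1 : 1 <= d%:R :> R by rewrite ler1n.
move=> lt'; apply: subcritical_large => //; first lra.
nra.
Qed.

End regimes.

Theorem proposition2p2 (R : realType) (d : nat) (hd : (1 <= d)%N) :
  exists p1 p2 : R, [/\ 0 < p1, p1 < p2, p2 < 1, p2 <= pcd R d &
    forall p : R, 0 <= p <= 1 -> ~~ (p1 <= p <= p2) ->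
    forall mu : probability (config d) R, bernoulli_product p mu ->
    gibbs (thinned_measure mu)].
Proof.
have D1 : 1 <= d%:R :> R by rewrite ler1n.
exists (1 / (16 * d%:R ^+ 2)), (pcd R d); split => //.
- by rewrite divr_gt0//; nra.
- apply: lt_le_trans (half_le_pcd _ hd); rewrite ltr_pdivrMr; nra.
- exact: pcd_lt1.
move=> p /andP[p0 p1] out mu mu_p.
have [pe|pne] := pselect (p = 0 \/ p = 1); first exact: endpoint_gibbs mu_p hd pe.
have p0' : 0 < p by rewrite lt_neqAle p0 andbT; apply/eqP => e; apply: pne; left.
have p1' : p < 1 by rewrite lt_neqAle p1 andbT; apply/eqP => e; apply: pne; right.
apply: (subcritical_gibbs mu_p p0' p1').
move: out; rewrite negb_and -!ltNge => /orP[small|large].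
  by apply: subcritical_small => //; rewrite p0 ltW.
exact: subcritical_above_pcd.
Qed.
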